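(* It is relatively consistent with ZFC that there exists a m.a.d. family of functions $\mathcal{A}\subseteq\omega^\omega$ which, as a subset of the Baire space $\omega^\omega$, is not $s$-measurable. That is, if ZFC is consistent, then so is ZFC together with this assertion.
   Context: Two functions $f,g\in\omega^\omega$ are eventually different if $f\cap g$ (the intersection of their graphs) is a finite subset of $\omega\times\omega$. A family $\mathcal{A}\subseteq\omega^\omega$ is almost disjoint (a.d.) if any two distinct members of $\mathcal{A}$ are eventually different. A m.a.d. family of functions is an a.d. family $\mathcal{A}\subseteq\omega^\omega$ that is maximal with respect to inclusion among a.d. families contained in $\omega^\omega$. Let $\mathrm{Perf}(\omega^\omega)$ denote the set of nonempty perfect subsets of the Baire space $\omega^\omega$ (closed, without isolated points). A set $A\subseteq\omega^\omega$ is $s$-measurable if for every $P\in\mathrm{Perf}(\omega^\omega)$ there is $Q\in\mathrm{Perf}(\omega^\omega)$ with $Q\subseteq P$ and either $Q\subseteq A$ or $Q\cap A=\emptyset$. *)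

(* Defs.v *)
From Stdlib Require Import List Arith.
Import ListNotations.

(** * First-order logic over the signature {∈} with equality *)

(* Terms are variables, represented by de Bruijn indices. The connectives
   absent from this type are the classical abbreviations given below. *)
Inductive form : Type :=
| Mem (i j : nat)
| Eq (i j : nat)
| Bot
| Imp (p q : form)
| All (p : form).

Definition Neg p := Imp p Bot.
Definition And p q := Neg (Imp p (Neg q)).
Definition Or p q := Imp (Neg p) q.
Definition Iff p q := And (Imp p q) (Imp q p).
Definition Ex p := Neg (All (Neg p)).

Definition up (r : nat -> nat) (i : nat) : nat :=
  match i with 0 => 0 | S k => S (r k) end.

Fixpoint rename (r : nat -> nat) (p : form) : form :=
  match p with
  | Mem i j => Mem (r i) (r j)
  | Eq i j => Eq (r i) (r j)
  | Bot => Bot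
  | Imp p q => Imp (rename r p) (rename r q)
  | All p => All (rename (up r) p)
  end.

Definition shift : form -> form := rename S.

(* [inst i p] is the instance p[i/0] of the body p of a quantifier. *)
Definition inst (i : nat) : form -> form :=
  rename (fun k => match k with 0 => i | S k => k end).

(* Classical natural deduction. *)
Inductive prv : list form -> form -> Prop :=
| prv_hyp G p : In p G -> prv G p
| prv_impI G p q : prv (p :: G) q -> prv G (Imp p q)
| prv_impE G p q : prv G (Imp p q) -> prv G p -> prv G q
| prv_raa G p : prv (Neg p :: G) Bot -> prv G p
| prv_allI G p : prv (map shift G) p -> prv G (All p)
| prv_allE G p i : prv G (All p) -> prv G (inst i p)
| prv_refl G i : prv G (Eq i i)
| prv_eqE G p i j : prv G (Eq i j) -> prv G (inst i p) -> prv G (inst j p).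

Definition theory := form -> Prop.

Definition provable (T : theory) (p : form) : Prop :=
  exists G, (forall q, In q G -> T q) /\ prv G p.

Definition consistent (T : theory) : Prop := ~ provable T Bot.

Definition extend (T : theory) (p : form) : theory := fun q => T q \/ q = p.

(* [fbound p] is the least n such that all free variables of p are < n. *)
Fixpoint fbound (p : form) : nat :=
  match p with
  | Mem i j | Eq i j => Nat.max (S i) (S j)
  | Bot => 0
  | Imp p q => Nat.max (fbound p) (fbound q)
  | All p => pred (fbound p)
  end.

Definition closure (p : form) : form := Nat.iter (fbound p) All p.

(** * Writing formulas with named bound variables *)

(* An [fml] is a formula to be placed under [d] quantifiers, as a function of
   [d]; a [var] gives, at each depth, the index that refers to a fixed
   quantifier. The variable bound by a quantifier at depth [d] has index
   [d' - S d] at any depth [d' > d]. A closed formula F denotes [F 0]. *)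
Definition fml := nat -> form.
Definition var := nat -> nat.

Definition fall (F : var -> fml) : fml :=
  fun d => All (F (fun d' => d' - S d) (S d)).
Definition fex (F : var -> fml) : fml :=
  fun d => Ex (F (fun d' => d' - S d) (S d)).

Declare Scope fml_scope.
Delimit Scope fml_scope with fml.
Bind Scope fml_scope with fml.

Notation "x ∈ y" := ((fun d => Mem (x d) (y d)) : fml)
  (at level 70) : fml_scope.
Notation "x ≐ y" := ((fun d => Eq (x d) (y d)) : fml)
  (at level 70) : fml_scope.
Notation "¬ p" := ((fun d => Neg (p%fml d)) : fml)
  (at level 75, right associativity) : fml_scope.
Notation "p ∧ q" := ((fun d => And (p%fml d) (q%fml d)) : fml)
  (at level 80, right associativity) : fml_scope.
Notation "p ∨ q" := ((fun d => Or (p%fml d) (q%fml d)) : fml)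
  (at level 85, right associativity) : fml_scope.
Notation "p ⇒ q" := ((fun d => Imp (p%fml d) (q%fml d)) : fml)
  (at level 90, right associativity) : fml_scope.
Notation "p ⇔ q" := ((fun d => Iff (p%fml d) (q%fml d)) : fml)
  (at level 95, no associativity) : fml_scope.
Notation "∀ x .. y , p" := (fall (fun x => .. (fall (fun y => p)) ..))
  (at level 10, x binder, y binder, p at level 200) : fml_scope.
Notation "∃ x .. y , p" := (fex (fun x => .. (fex (fun y => p)) ..))
  (at level 10, x binder, y binder, p at level 200) : fml_scope.

Open Scope fml_scope.

(* For a formula p used in an axiom schema: index 0 (resp. 0 and 1) of p is the
   distinguished variable; the remaining indices are parameters, which stay
   free at depth 0 and are later bound by [closure]. *)
Definition schema1 (p : form) (x : var) : fml :=
  fun d => rename (fun k => match k with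
                            | 0 => x d
                            | S k => d + k
                            end) p.
Definition schema2 (p : form) (x y : var) : fml :=
  fun d => rename (fun k => match k with
                            | 0 => x d
                            | 1 => y d
                            | S (S k) => d + k
                            end) p.

(** * Basic set theory *)

Definition subset (a b : var) : fml := ∀ x, x ∈ a ⇒ x ∈ b.
Definition empty (a : var) : fml := ∀ x, ¬ x ∈ a.
Definition disjoint (a b : var) : fml := ∀ x, x ∈ a ⇒ ¬ x ∈ b.
Definition is_inter (c a b : var) : fml := ∀ x, x ∈ c ⇔ x ∈ a ∧ x ∈ b.

Definition is_pair (p a b : var) : fml := ∀ x, x ∈ p ⇔ x ≐ a ∨ x ≐ b.

(* Kuratowski: p = {{a}, {a, b}} *)
Definition is_opair (p a b : var) : fml :=
  ∃ s t, is_pair s a a ∧ is_pair t a b ∧ is_pair p s t.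

Definition maps (f x y : var) : fml := ∃ p, is_opair p x y ∧ p ∈ f.

Definition is_fun (f a b : var) : fml :=
  (∀ p, p ∈ f ⇒ ∃ x y, x ∈ a ∧ y ∈ b ∧ is_opair p x y) ∧
  (∀ x, x ∈ a ⇒ ∃ y, maps f x y ∧ ∀ z, maps f x z ⇒ z ≐ y).

Definition is_bij (f a b : var) : fml :=
  is_fun f a b ∧
  (∀ y, y ∈ b ⇒ ∃ x, maps f x y ∧ ∀ z, maps f z y ⇒ z ≐ x).

Definition is_succ (s n : var) : fml := ∀ x, x ∈ s ⇔ x ∈ n ∨ x ≐ n.

Definition inductive (i : var) : fml :=
  (∃ e, empty e ∧ e ∈ i) ∧
  (∀ n, n ∈ i ⇒ ∃ s, is_succ s n ∧ s ∈ i).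

Definition is_omega (w : var) : fml :=
  inductive w ∧ ∀ i, inductive i ⇒ subset w i.

(** * ZFC *)

Definition extensionality : fml := ∀ a b, (∀ x, x ∈ a ⇔ x ∈ b) ⇒ a ≐ b.

Definition foundation : fml :=
  ∀ a, (∃ x, x ∈ a) ⇒ ∃ x, x ∈ a ∧ disjoint x a.

Definition pairing : fml := ∀ a b, ∃ p, is_pair p a b.

Definition union : fml := ∀ a, ∃ u, ∀ x, x ∈ u ⇔ ∃ y, y ∈ a ∧ x ∈ y.

Definition power_set : fml := ∀ a, ∃ b, ∀ x, x ∈ b ⇔ subset x a.

Definition infinity : fml := ∃ i, inductive i.

Definition separation (p : form) : fml :=
  ∀ a, ∃ b, ∀ x, x ∈ b ⇔ x ∈ a ∧ schema1 p x.

Definition replacement (p : form) : fml :=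
  (∀ x y z, schema2 p x y ∧ schema2 p x z ⇒ y ≐ z) ⇒
  ∀ a, ∃ b, ∀ y, y ∈ b ⇔ ∃ x, x ∈ a ∧ schema2 p x y.

Definition choice : fml :=
  ∀ a, (∀ x, x ∈ a ⇒ ∃ y, y ∈ x) ⇒
  ∃ f, (∃ u, is_fun f a u) ∧ ∀ x, x ∈ a ⇒ ∃ y, y ∈ x ∧ maps f x y.

Inductive ZFC : theory :=
| ZFC_extensionality : ZFC (extensionality 0)
| ZFC_foundation : ZFC (foundation 0)
| ZFC_pairing : ZFC (pairing 0)
| ZFC_union : ZFC (union 0)
| ZFC_power_set : ZFC (power_set 0)
| ZFC_infinity : ZFC (infinity 0)
| ZFC_separation p : ZFC (closure (separation p 0))
| ZFC_replacement p : ZFC (closure (replacement p 0))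
| ZFC_choice : ZFC (choice 0).

(** * Families of functions and the Baire space *)

(* Throughout, [ω] stands for the set of natural numbers (as von Neumann
   ordinals) and [N] for the set of all functions from ω to ω. *)

Definition is_baire (N ω : var) : fml := ∀ f, f ∈ N ⇔ is_fun f ω ω.

Definition finite (ω a : var) : fml := ∃ n h, n ∈ ω ∧ is_bij h n a.

Definition eventually_different (ω f g : var) : fml :=
  ∃ c, is_inter c f g ∧ finite ω c.

Definition almost_disjoint (ω N A : var) : fml :=
  subset A N ∧
  ∀ f g, f ∈ A ∧ g ∈ A ∧ ¬ f ≐ g ⇒ eventually_different ω f g.

Definition mad (ω N A : var) : fml :=
  almost_disjoint ω N A ∧
  ∀ B, almost_disjoint ω N B ∧ subset A B ⇒ B ≐ A.

(* f and g have the same restriction to n = {0, ..., n-1} *)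
Definition agree (f g n : var) : fml :=
  ∀ k, k ∈ n ⇒ ∃ y, maps f k y ∧ maps g k y.

(* The topology of N is generated by the sets of all g that agree with a given
   f below a given n. *)
Definition is_open (ω N U : var) : fml :=
  subset U N ∧
  ∀ f, f ∈ U ⇒ ∃ n, n ∈ ω ∧ ∀ g, g ∈ N ∧ agree f g n ⇒ g ∈ U.

Definition is_closed (ω N C : var) : fml :=
  subset C N ∧
  ∃ U, is_open ω N U ∧ ∀ f, f ∈ N ⇒ (f ∈ C ⇔ ¬ f ∈ U).

Definition isolated (ω N P f : var) : fml :=
  ∃ U, is_open ω N U ∧ ∀ g, (g ∈ U ∧ g ∈ P) ⇔ g ≐ f.

Definition perfect (ω N P : var) : fml :=
  (∃ f, f ∈ P) ∧ is_closed ω N P ∧ ∀ f, f ∈ P ⇒ ¬ isolated ω N P f.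

Definition s_measurable (ω N A : var) : fml :=
  ∀ P, perfect ω N P ⇒
  ∃ Q, perfect ω N Q ∧ subset Q P ∧ (subset Q A ∨ disjoint Q A).

Definition mad_not_s_measurable : fml :=
  ∃ ω N, is_omega ω ∧ is_baire N ω ∧
  ∃ A, mad ω N A ∧ ¬ s_measurable ω N A.

(* Main.v *)
(* The assertion is a theorem of ZFC, so by the completeness theorem it suffices
   to verify it in an arbitrary model of ZFC.

   Identify the natural numbers with the nodes of a binary tree (n has children
   2n+1 and 2n+2). The branches of this tree form a perfect set P of functions,
   and it is almost disjoint: two branches never meet again after splitting.
   Let B be a Bernstein subset of P, i.e. B and P \ B meet every perfect
   Q contained in P. For f in P \ B let f' be f with the value at 0 changed.
   Then B together with all the f' is almost disjoint; extend it to a m.a.d.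
   family A. No f in P \ B lies in A, since f and f' differ and meet infinitely
   often; so A meets P exactly in B, and P witnesses that A is not
   s-measurable.

   For the Bernstein set, code every perfect subset of P by two subsets w of
   omega, one containing 0 and one not, and choose distinct points p(w) in the
   perfect sets coded. This is possible since each of these sets maps onto the
   power set of omega. The points p(w) with 0 not in w form B. *)

From Stdlib Require Import List Arith Lia Cantor Classical ClassicalEpsilon.
From Stdlib Require Import FunctionalExtensionality PropExtensionality.
Require Import Defs.
Import ListNotations.

(** * Completeness *)

(** The model supplied by completeness is arbitrary: its natural numbers may be nonstandard and its
    sets are not types or predicates of Rocq. Every subset that the argument forms has to come from
    separation, for a predicate defined by a formula with parameters; hence the calculus of
    definable predicates and terms, in which Rocq functions on the model stand in for formulas.
    Ordinals are avoided. Transfinite recursion is replaced by a Bourbaki-Witt tower, the least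
    family of subsets closed under an increasing operator and under unions; it serves to well-order
    a set, to choose points one after another and to reach maximality. Cardinals are replaced by
    surjections: a set counts as small when it does not map onto the set of codes. A perfect set of
    branches is not small, since the turns that a branch takes at the splitting nodes of the set can
    spell out any subset of omega. The change at 0 works because all branches have the value 0 there
    and the modified function has the value 1. A second code for each perfect set is available
    because the root 0 lies on every branch, so that its membership in a code carries no
    information. *)

Definition scons {X : Type} (x : X) (e : nat -> X) (n : nat) : X :=
  match n with 0 => x | S k => e k end.

Fixpoint sat {D : Type} (E : D -> D -> Prop) (e : nat -> D) (p : form) : Prop :=
  match p with
  | Mem i j => E (e i) (e j)
  | Eq i j => e i = e j
  | Bot => False
  | Imp p q => sat E e p -> sat E e q
  | All p => forall x, sat E (scons x e) p
  end.

Lemma sat_ext {D : Type} (E : D -> D -> Prop) (p : form) :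
  forall e e', (forall n, n < fbound p -> e n = e' n) ->
  sat E e p <-> sat E e' p.
Proof.
  induction p as [i j|i j| |p IHp q IHq|p IHp]; simpl; intros e e' H.
  - rewrite (H i), (H j) by lia. reflexivity.
  - rewrite (H i), (H j) by lia. reflexivity.
  - reflexivity.
  - rewrite (IHp e e'), (IHq e e'); [reflexivity|intros; apply H; lia..].
  - enough (K : forall x, sat E (scons x e) p <-> sat E (scons x e') p)
      by (split; intros L x; apply K, L).
    intros x. apply IHp. intros [|n] Hn; simpl; [reflexivity|apply H; lia].
Qed.

Lemma sat_rename {D : Type} (E : D -> D -> Prop) (p : form) :
  forall r e, sat E e (rename r p) <-> sat E (fun n => e (r n)) p.
Proof.
  induction p as [i j|i j| |p IHp q IHq|p IHp]; simpl; intros r e;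
    try reflexivity.
  - rewrite IHp, IHq. reflexivity.
  - enough (K : forall x, sat E (scons x e) (rename (up r) p) <->
                          sat E (scons x (fun n => e (r n))) p)
      by (split; intros L x; apply K, L).
    intros x. rewrite IHp. apply sat_ext. intros [|n] _; reflexivity.
Qed.

Lemma sat_inst {D : Type} (E : D -> D -> Prop) e i p :
  sat E e (inst i p) <-> sat E (scons (e i) e) p.
Proof.
  unfold inst. rewrite sat_rename. apply sat_ext. intros [|n] _; reflexivity.
Qed.

Lemma soundness {D : Type} (E : D -> D -> Prop) G p :
  prv G p -> forall e, (forall q, In q G -> sat E e q) -> sat E e p.
Proof.
  induction 1 as [G p Hp|G p q _ IH|G p q _ IH1 _ IH2|G p _ IH|G p _ IH
                 |G p i _ IH|G i|G p i j _ IH1 _ IH2]; intros e He.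
  - auto.
  - simpl. intros Hp. apply IH. intros r [<-|Hr]; auto.
  - exact (IH1 e He (IH2 e He)).
  - apply NNPP. intros Hn. apply (IH e).
    intros r [<-|Hr]; [exact Hn|auto].
  - simpl. intros x. apply IH. intros q Hq.
    apply in_map_iff in Hq. destruct Hq as [r [<- Hr]].
    unfold shift. rewrite sat_rename. apply (He r Hr).
  - rewrite sat_inst. apply (IH e He).
  - reflexivity.
  - rewrite sat_inst. rewrite <- (IH1 e He : e i = e j).
    rewrite <- sat_inst. auto.
Qed.

Lemma rename_ext p : forall r s,
  (forall n, n < fbound p -> r n = s n) -> rename r p = rename s p.
Proof.
  induction p as [i j|i j| |p IHp q IHq|p IHp]; simpl; intros r s H; f_equal.
  1-4: apply H; lia.
  - reflexivity.
  - apply IHp; intros; apply H; lia.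
  - apply IHq; intros; apply H; lia.
  - apply IHp. intros [|n] Hn; simpl; [reflexivity|f_equal; apply H; lia].
Qed.

Lemma rename_comp p : forall r s,
  rename r (rename s p) = rename (fun n => r (s n)) p.
Proof.
  induction p as [i j|i j| |p IHp q IHq|p IHp]; simpl; intros r s; f_equal;
    auto.
  rewrite IHp. apply rename_ext. intros [|n] _; reflexivity.
Qed.

Lemma rename_id p r : (forall n, n < fbound p -> r n = n) -> rename r p = p.
Proof.
  revert r. induction p as [i j|i j| |p IHp q IHq|p IHp]; simpl; intros r H;
    f_equal.
  1-4: apply H; lia.
  - reflexivity.
  - apply IHp; intros; apply H; lia.
  - apply IHq; intros; apply H; lia.
  - apply IHp. intros [|n] Hn; simpl; [reflexivity|f_equal; apply H; lia].
Qed.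

(** * Renaming in derivations and fresh variables *)

Lemma prv_weaken G p : prv G p -> forall G', incl G G' -> prv G' p.
Proof.
  induction 1 as [G p Hp|G p q _ IH|G p q _ IH1 _ IH2|G p _ IH|G p _ IH
                 |G p i _ IH|G i|G p i j _ IH1 _ IH2]; intros G' HG.
  - apply prv_hyp; auto.
  - apply prv_impI, IH. intros r [<-|Hr]; [left|right]; auto.
  - eapply prv_impE; eauto.
  - apply prv_raa, IH. intros r [<-|Hr]; [left|right]; auto.
  - apply prv_allI, IH. apply incl_map, HG.
  - apply prv_allE; auto.
  - apply prv_refl.
  - eapply prv_eqE; eauto.
Qed.

Lemma prv_rename G p : prv G p ->
  forall r, prv (map (rename r) G) (rename r p).
Proof.
  induction 1 as [G p Hp|G p q _ IH|G p q _ IH1 _ IH2|G p _ IH|G p _ IH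
                 |G p i _ IH|G i|G p i j _ IH1 _ IH2]; intros r; simpl.
  - apply prv_hyp, in_map, Hp.
  - apply prv_impI, IH.
  - eapply prv_impE; [apply IH1|apply IH2].
  - apply prv_raa, IH.
  - apply prv_allI. rewrite map_map.
    erewrite map_ext; [apply (prv_weaken _ _ (IH (up r)))|].
    + rewrite map_map. apply incl_refl.
    + intros q. unfold shift. rewrite !rename_comp. reflexivity.
  - replace (rename r (inst i p)) with (inst (r i) (rename (up r) p)).
    + apply prv_allE, IH.
    + unfold inst. rewrite !rename_comp. apply rename_ext.
      intros [|n] _; reflexivity.
  - apply prv_refl.
  - assert (K : forall i, rename r (inst i p) = inst (r i) (rename (up r) p)).
    { intros k. unfold inst. rewrite !rename_comp. apply rename_ext.
      intros [|n] _; reflexivity. }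
    rewrite K. apply (prv_eqE _ _ (r i)); [apply IH1|].
    rewrite <- K. apply IH2.
Qed.

(** The bounds make [c] fresh for [G] and [All p], so it can serve as eigenvariable. The renaming
    [r] sends [c] to 0 and every other [k] to [S k]; it acts as [shift] on [G] and undoes [inst c]
    on [p]. *)
Lemma prv_generalize G p c : (forall q, In q G -> fbound q <= c) ->
  fbound p <= S c -> prv G (inst c p) -> prv G (All p).
Proof.
  intros HG Hp H. apply prv_allI.
  set (r := fun k => if Nat.eq_dec k c then 0 else S k).
  replace (map shift G) with (map (rename r) G).
  - replace p with (rename r (inst c p)); [apply prv_rename, H|].
    unfold inst. rewrite rename_comp. apply rename_id.
    intros [|n] Hn; unfold r.
    + destruct (Nat.eq_dec c c); congruence.
    + destruct (Nat.eq_dec n c); [lia|reflexivity].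
  - apply map_ext_in. intros q Hq. apply rename_ext. intros n Hn.
    specialize (HG q Hq). unfold r. destruct (Nat.eq_dec n c); lia.
Qed.

Lemma fbound_closure p : fbound (closure p) = 0.
Proof.
  unfold closure.
  assert (H : forall n, fbound (Nat.iter n All p) = fbound p - n).
  { induction n as [|n IH]; simpl; [|rewrite IH]; lia. }
  rewrite H. lia.
Qed.

(** The components of a code are not structural subterms, so the recursion runs on fuel, and
    [enum_form] reads the fuel from its argument as well. Tags 0 to 3 mark the constructors with
    arguments; any other tag means [Bot]. *)
Fixpoint decode_form (fuel n : nat) : form :=
  match fuel with
  | 0 => Bot
  | S k =>
      let (t, m) := of_nat n in
      let (a, b) := of_nat m in
      match t with
      | 0 => Mem a b
      | 1 => Eq a b
      | 2 => Imp (decode_form k a) (decode_form k b)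
      | 3 => All (decode_form k m)
      | _ => Bot
      end
  end.

(** Stated for all large enough fuel, so that both halves of an implication can be decoded with a
    common amount. *)
Lemma decode_form_surj p :
  exists k0 n, forall k, k0 <= k -> decode_form k n = p.
Proof.
  induction p as [i j|i j| |p [k1 [n1 H1]] q [k2 [n2 H2]]|p [k1 [n1 H1]]].
  - exists 1, (to_nat (0, to_nat (i, j))).
    intros [|k] Hk; [lia|]. cbn -[of_nat to_nat]. now rewrite !cancel_of_to.
  - exists 1, (to_nat (1, to_nat (i, j))).
    intros [|k] Hk; [lia|]. cbn -[of_nat to_nat]. now rewrite !cancel_of_to.
  - exists 0, (to_nat (4, 0)). intros [|k] _; [reflexivity|].
    cbn -[of_nat to_nat]. rewrite !cancel_of_to. now destruct (of_nat 0).
  - exists (S (k1 + k2)), (to_nat (2, to_nat (n1, n2))).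
    intros [|k] Hk; [lia|]. cbn -[of_nat to_nat]. rewrite !cancel_of_to.
    rewrite H1, H2 by lia. reflexivity.
  - exists (S k1), (to_nat (3, n1)).
    intros [|k] Hk; [lia|]. cbn -[of_nat to_nat]. rewrite !cancel_of_to.
    destruct (of_nat n1). rewrite H1 by lia. reflexivity.
Qed.

Definition enum_form (n : nat) : form :=
  let (k, m) := of_nat n in decode_form k m.

Lemma enum_form_surj p : exists n, enum_form n = p.
Proof.
  destruct (decode_form_surj p) as [k [n H]]. exists (to_nat (k, n)).
  unfold enum_form. rewrite cancel_of_to. apply H. lia.
Qed.

(** * Henkin construction and term model *)

Section Henkin.

Context (T : theory).
Hypothesis T_closed : forall p, T p -> fbound p = 0.
Hypothesis T_consistent : consistent T.

(** The axioms of [T] are kept apart from [G]: they are closed, so the freshness of a variable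
    depends on the finite list [G] alone. *)
Definition derives (G : list form) (p : form) : Prop :=
  exists A, (forall q, In q A -> T q) /\ prv (A ++ G) p.

Definition bound_list (G : list form) : nat :=
  fold_right (fun p n => Nat.max (fbound p) n) 0 G.

Lemma bound_list_le G p : In p G -> fbound p <= bound_list G.
Proof.
  induction G as [|q G IH]; simpl; [easy|].
  intros [->|H]; [lia|specialize (IH H); lia].
Qed.

(** The variables themselves act as Henkin constants. Every stage is a finite list, so a fresh
    variable exists, and it is made a counterexample to the rejected universal formula. *)
Definition witness (p : form) (G : list form) : list form :=
  match p with
  | All q => [Neg (inst (bound_list (p :: G)) q)]
  | _ => []
  end.

Fixpoint stage (n : nat) : list form :=
  match n with
  | 0 => []
  | S k =>
      let p := enum_form k in
      if excluded_middle_informative (derives (p :: stage k) Bot)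
      then witness p (stage k) ++ Neg p :: stage k
      else p :: stage k
  end.

Lemma derives_incl G G' p : incl G G' -> derives G p -> derives G' p.
Proof.
  intros HG [A [HA H]]. exists A. split; [exact HA|].
  apply (prv_weaken _ _ H). apply incl_app_app; [apply incl_refl|exact HG].
Qed.

Lemma derives_hyp G p : In p G -> derives G p.
Proof. intros H. exists []. split; [easy|]. now apply prv_hyp. Qed.

Lemma derives_axiom G p : T p -> derives G p.
Proof.
  intros H. exists [p]. split; [intros q [<-|[]]; exact H|].
  apply prv_hyp. now left.
Qed.

Lemma derives_move G p q : derives (p :: G) q -> derives G (Imp p q).
Proof.
  intros [A [HA H]]. exists A. split; [exact HA|]. apply prv_impI.
  apply (prv_weaken _ _ H). intros r Hr. apply in_app_iff in Hr.
  simpl in *. rewrite in_app_iff. tauto.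
Qed.

Lemma derives_mp G p q : derives G (Imp p q) -> derives G p -> derives G q.
Proof.
  intros [A [HA H]] [B [HB K]]. exists (A ++ B). split.
  - intros r Hr. apply in_app_iff in Hr. destruct Hr; auto.
  - apply (prv_impE _ p).
    + apply (prv_weaken _ _ H). intros r. rewrite !in_app_iff. tauto.
    + apply (prv_weaken _ _ K). intros r. rewrite !in_app_iff. tauto.
Qed.

Lemma derives_raa G p : derives (Neg p :: G) Bot -> derives G p.
Proof.
  intros H. apply derives_move in H. destruct H as [A [HA H]].
  exists A. split; [exact HA|]. apply prv_raa.
  apply (prv_impE _ (Neg p)); [|apply prv_hyp; now left].
  apply (prv_weaken _ _ H). intros r Hr. now right.
Qed.

Lemma derives_generalize G p c : (forall q, In q G -> fbound q <= c) ->
  fbound p <= S c -> derives G (inst c p) -> derives G (All p).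
Proof.
  intros HG Hp [A [HA H]]. exists A. split; [exact HA|].
  apply (prv_generalize _ _ c); [|exact Hp|exact H].
  intros q Hq. apply in_app_iff in Hq. destruct Hq as [Hq|Hq]; [|auto].
  rewrite (T_closed q); [lia|auto].
Qed.

Lemma stage_consistent n : ~ derives (stage n) Bot.
Proof.
  induction n as [|n IH]; simpl.
  - intros [A HA]. rewrite app_nil_r in HA. apply T_consistent. now exists A.
  - set (p := enum_form n) in *. set (G := stage n) in *.
    destruct (excluded_middle_informative (derives (p :: G) Bot)) as [H|H];
      [|exact H].
    apply derives_move in H. fold (Neg p) in H.
    assert (K : ~ derives (Neg p :: G) Bot).
    { intros K. apply IH. apply (derives_mp _ (Neg p)); [|exact H].
      now apply derives_move. }
    clearbody p. destruct p as [i j|i j| |p1 p2|p]; simpl; try exact K.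
    (* If the counterexample at the fresh variable [c] led to a contradiction, generalization over
       [c] would derive [All p] against [Neg (All p)]. *)
    intros L. apply derives_raa in L.
    set (c := Nat.max _ _) in L.
    apply derives_generalize in L.
    + apply K. apply (derives_mp _ (All p)); [|exact L].
      apply derives_hyp. now left.
    + intros q [<-|Hq]; unfold c; simpl; [lia|].
      apply bound_list_le in Hq. unfold G in *. lia.
    + unfold c. simpl. lia.
Qed.

Lemma stage_mono n m : n <= m -> incl (stage n) (stage m).
Proof.
  induction 1 as [|m _ IH]; [apply incl_refl|].
  apply (incl_tran IH). simpl.
  destruct (excluded_middle_informative _).
  - apply incl_appr. apply incl_tl, incl_refl.
  - apply incl_tl, incl_refl.
Qed.

Definition limit (p : form) : Prop := exists n, derives (stage n) p.

Lemma limit_mp p q : limit (Imp p q) -> limit p -> limit q.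
Proof.
  intros [n H] [m K]. exists (n + m).
  apply (derives_mp _ p); eapply derives_incl;
    [apply (stage_mono n)|exact H|apply (stage_mono m)|exact K]; lia.
Qed.

Lemma limit_Bot : ~ limit Bot.
Proof. intros [n H]. exact (stage_consistent n H). Qed.

Lemma limit_complete p : limit p \/ limit (Neg p).
Proof.
  destruct (enum_form_surj p) as [n Hn].
  destruct (excluded_middle_informative (derives (p :: stage n) Bot)) as [H|H].
  - right. exists n. now apply derives_move.
  - left. exists (S n). simpl. rewrite Hn.
    destruct (excluded_middle_informative _); [easy|].
    apply derives_hyp. now left.
Qed.

Lemma limit_prv p : prv [] p -> limit p.
Proof. intros H. exists 0, []. split; [easy|exact H]. Qed.

Lemma limit_Imp p q : limit (Imp p q) <-> (limit p -> limit q).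
Proof.
  split; [apply limit_mp|]. intros H.
  destruct (limit_complete p) as [K|K].
  - apply (limit_mp q); [|auto]. apply limit_prv.
    apply prv_impI, prv_impI, prv_hyp. simpl; auto.
  - apply (limit_mp (Neg p)); [|exact K]. apply limit_prv.
    apply prv_impI, prv_impI, prv_raa.
    apply (prv_impE _ p); apply prv_hyp; simpl; auto.
Qed.

(** From right to left the Henkin witness is used: the stage that rejects [All p] also adds the
    negation of one of its instances. *)
Lemma limit_All p : limit (All p) <-> forall i, limit (inst i p).
Proof.
  split.
  - intros H i. apply (limit_mp (All p)); [|exact H]. apply limit_prv.
    apply prv_impI, prv_allE, prv_hyp. now left.
  - intros H. apply NNPP. intros K.
    destruct (enum_form_surj (All p)) as [n Hn].
    destruct (excluded_middle_informative (derives (All p :: stage n) Bot))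
      as [L|L].
    + apply limit_Bot. apply (limit_mp (inst (bound_list (All p :: stage n)) p)).
      * exists (S n). simpl. rewrite Hn.
        destruct (excluded_middle_informative _); [|easy].
        apply derives_hyp. now left.
      * apply H.
    + apply K. exists (S n). simpl. rewrite Hn.
      destruct (excluded_middle_informative _); [easy|].
      apply derives_hyp. now left.
Qed.

Lemma limit_eqE p i j : limit (Eq i j) -> limit (inst i p) -> limit (inst j p).
Proof.
  intros H K. apply (limit_mp (inst i p)); [|exact K].
  apply (limit_mp (Eq i j)); [|exact H]. apply limit_prv.
  apply prv_impI, prv_impI. apply (prv_eqE _ p i j); apply prv_hyp; simpl; auto.
Qed.

Lemma limit_refl i : limit (Eq i i).
Proof. apply limit_prv, prv_refl. Qed.

Lemma limit_sym i j : limit (Eq i j) -> limit (Eq j i).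
Proof.
  (* The context has its hole at index 0, and [S i] is [i] shifted past the hole. *)
  intros H. apply (limit_eqE (Eq 0 (S i)) i j H). apply limit_refl.
Qed.

Lemma limit_trans i j k : limit (Eq i j) -> limit (Eq j k) -> limit (Eq i k).
Proof. intros H K. apply (limit_eqE (Eq (S i) 0) j k K). exact H. Qed.

(* The elements of the term model are canonical representatives of the classes
   of variables under provable equality. *)
Definition rep (i : nat) : nat :=
  epsilon (inhabits 0) (fun j => limit (Eq i j)).

Lemma rep_eq i : limit (Eq i (rep i)).
Proof.
  apply (epsilon_spec (inhabits 0) (fun j => limit (Eq i j))).
  exists i. apply limit_refl.
Qed.

(** [epsilon] depends on the predicate alone, and provably equal variables yield the same predicate
    by extensionality. *)
Lemma rep_ext i j : limit (Eq i j) -> rep i = rep j.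
Proof.
  intros H. unfold rep. f_equal. extensionality k.
  apply propositional_extensionality. split.
  - apply limit_trans. now apply limit_sym.
  - now apply limit_trans.
Qed.

Definition term_model : Type := {i : nat | rep i = i}.

Definition term_class (i : nat) : term_model :=
  exist _ (rep i) (eq_sym (rep_ext _ _ (rep_eq i))).

(** [sat] reads [Eq] as Rocq equality, so each class needs a single element. Uniqueness of identity
    proofs on [nat] removes the proof component of the pairs. *)
Lemma term_model_eq (a b : term_model) :
  limit (Eq (proj1_sig a) (proj1_sig b)) -> a = b.
Proof.
  destruct a as [i Hi], b as [j Hj]. simpl. intros H.
  apply rep_ext in H. assert (K : i = j) by congruence.
  destruct K. f_equal. apply (Eqdep_dec.UIP_dec Nat.eq_dec).
Qed.

Definition term_mem (a b : term_model) : Prop :=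
  limit (Mem (proj1_sig a) (proj1_sig b)).

Lemma sat_term_model p : forall e : nat -> term_model,
  sat term_mem e p <-> limit (rename (fun n => proj1_sig (e n)) p).
Proof.
  induction p as [i j|i j| |p IHp q IHq|p IHp]; intros e; simpl.
  - reflexivity.
  - split; [|apply term_model_eq]. intros ->. apply limit_refl.
  - split; [easy|apply limit_Bot].
  - rewrite limit_Imp, IHp, IHq. reflexivity.
  - rewrite limit_All.
    set (s := rename _ p).
    assert (K : forall x : term_model, sat term_mem (scons x e) p <->
                  limit (inst (proj1_sig x) s)).
    { intros x. rewrite IHp. unfold s, inst. rewrite rename_comp.
      erewrite rename_ext; [reflexivity|]. intros [|n] _; reflexivity. }
    split.
    (* The model ranges over representatives only; provable equality carries the instance from
       [rep i] to [i]. *)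
    + intros H i. apply (limit_eqE _ (rep i)).
      * apply limit_sym, rep_eq.
      * exact (proj1 (K (term_class i)) (H _)).
    + intros H x. apply K, H.
Qed.

Lemma term_model_spec p e : T p -> sat term_mem e p.
Proof.
  intros H. rewrite sat_term_model, rename_id.
  - exists 0. now apply derives_axiom.
  - rewrite (T_closed p H). lia.
Qed.

End Henkin.

Theorem consistent_of_sat {D : Type} (E : D -> D -> Prop) (e : nat -> D) T :
  (forall p, T p -> sat E e p) -> consistent T.
Proof.
  intros H [G [HG K]]. apply (soundness E _ _ K e). auto.
Qed.

Theorem model_existence T : (forall p, T p -> fbound p = 0) -> consistent T ->
  exists (D : Type) (E : D -> D -> Prop) (e : nat -> D),
    forall p e', T p -> sat E e' p.
Proof.
  intros HT HC. exists (term_model T), (term_mem T), (fun n => term_class T n).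
  intros p e' Hp. now apply term_model_spec.
Qed.

(** * Definability with parameters *)

(** [point] is a default element: it makes [M] inhabited for [epsilon] and fills environments whose
    values do not matter. *)
Class zfc_model (M : Type) := {
  mem : M -> M -> Prop;
  point : M;
  zfc_sat : forall p e, ZFC p -> sat mem e p
}.

Declare Scope model_scope.
Delimit Scope model_scope with model.
Notation "x ∈ y" := (mem x y) : model_scope.
Open Scope model_scope.

(* Reads the classical abbreviations back as connectives, so that [interp] of
   a concrete formula computes to the statement it abbreviates. *)
Fixpoint interp {D : Type} (E : D -> D -> Prop) (e : nat -> D) (p : form)
  : Prop :=
  match p with
  | Mem i j => E (e i) (e j)
  | Eq i j => e i = e j
  | Bot => False
  | Imp p Bot =>
      match p with
      | Imp p (Imp q Bot) => interp E e p /\ interp E e q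
      | All (Imp p Bot) => exists x, interp E (scons x e) p
      | _ => ~ interp E e p
      end
  | Imp p q => interp E e p -> interp E e q
  | All p => forall x, interp E (scons x e) p
  end.

Lemma interp_imp {D : Type} (E : D -> D -> Prop) e p q : q <> Bot ->
  interp E e (Imp p q) = (interp E e p -> interp E e q).
Proof. destruct q; [reflexivity|reflexivity|congruence|reflexivity..]. Qed.

Fixpoint form_size (p : form) : nat :=
  match p with
  | Imp p q => S (form_size p + form_size q)
  | All p => S (form_size p)
  | _ => 1
  end.

(** Induction on the size of the formula, because [interp] passes several constructors at once when
    it recognizes a conjunction or an existential quantifier. Classical logic equates these with
    their encodings. *)
Lemma interp_sat {D : Type} (E : D -> D -> Prop) p e :
  interp E e p <-> sat E e p.
Proof.
  enough (H : forall n p e, form_size p < n -> interp E e p <-> sat E e p).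
  { apply (H (S (form_size p))). lia. }
  clear p e. induction n as [|n IH]; intros p e Hn; [lia|].
  assert (X : forall p e, form_size p < n ->
    (exists x, interp E (scons x e) p) <-> ~ forall x, ~ sat E (scons x e) p).
  { intros q e' Hq. split.
    - intros [x Hx] H. apply (H x), IH; assumption.
    - intros H. apply NNPP. intros K. apply H. intros x Hx. apply K.
      exists x. apply IH; assumption. }
  destruct p as [i j|i j| |p q|p]; try reflexivity.
  2: simpl in *; split; intros H x; apply IH; auto; lia.
  destruct (classic (q = Bot)) as [->|Hq].
  2: rewrite interp_imp by exact Hq; simpl in *; rewrite !IH by lia; reflexivity.
  assert (N : ~ interp E e p <-> sat E e (Imp p Bot)).
  { simpl in *. rewrite IH by lia. reflexivity. }
  destruct p as [| | |p q|p]; try exact N.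
  - destruct q as [| | |q1 q2|]; try exact N. destruct q2; try exact N.
    simpl in *. rewrite !IH by lia. tauto.
  - destruct p as [| | |p q|]; try exact N. destruct q; try exact N.
    simpl in *. apply X. lia.
Qed.

Section Definability.

Context {M : Type} {Z : zfc_model M}.

Notation env := (nat -> M).

(** Variables sit at even indices and parameters at odd ones, so a formula has an unlimited supply
    of both. *)
Definition merge (r c : env) : env :=
  fun k => if Nat.odd k then c (Nat.div2 k) else r (Nat.div2 k).

Lemma odd_double k : Nat.odd (2 * k) = false.
Proof. now rewrite Nat.odd_mul. Qed.

Lemma odd_succ_double k : Nat.odd (S (2 * k)) = true.
Proof. now rewrite Nat.odd_succ, Nat.even_mul. Qed.

Lemma merge_even r c k : merge r c (2 * k) = r k.
Proof. unfold merge. now rewrite odd_double, Nat.div2_double. Qed.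

Lemma merge_odd r c k : merge r c (S (2 * k)) = c k.
Proof. unfold merge. now rewrite odd_succ_double, Nat.div2_succ_double. Qed.

Lemma even_odd_cases (P : nat -> Prop) :
  (forall k, P (2 * k)) -> (forall k, P (S (2 * k))) -> forall n, P n.
Proof.
  intros H K n. destruct (Nat.Even_or_Odd n) as [[k ->]|[k ->]]; [apply H|].
  rewrite Nat.add_1_r. apply K.
Qed.

(* The parameters [c] are kept apart from the environment [r], whose variables
   get shifted under quantifiers. *)
Definition definable (P : env -> Prop) : Prop :=
  exists p c, forall r, P r <-> sat mem (merge r c) p.

Lemma definable_ext P Q : (forall r, P r <-> Q r) -> definable P -> definable Q.
Proof.
  intros H [p [c K]]. exists p, c. intros r. rewrite <- H. apply K.
Qed.

(** Moves a formula to a parameter environment [c'] that contains the old one, so that two formulas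
    can be brought to common parameters before they are combined. *)
Lemma definable_reindex P p c c' (r s : nat -> nat) :
  (forall e, P e <-> sat mem (merge e c) p) ->
  (forall k, c k = c' (s k)) ->
  exists q, forall e, P (fun k => e (r k)) <-> sat mem (merge e c') q.
Proof.
  intros H Hc.
  set (t k := if Nat.odd k then S (2 * s (Nat.div2 k)) else 2 * r (Nat.div2 k)).
  exists (rename t p). intros e. rewrite sat_rename, H.
  apply sat_ext. intros n _. revert n. apply even_odd_cases; intros k; unfold t.
  - now rewrite merge_even, odd_double, Nat.div2_double, merge_even.
  - now rewrite merge_odd, odd_succ_double, Nat.div2_succ_double, merge_odd.
Qed.

Lemma definable_rename P (s : nat -> nat) :
  definable P -> definable (fun r => P (fun k => r (s k))).
Proof.
  intros [p [c H]].
  destruct (definable_reindex P p c c s (fun k => k) H) as [q K]; [easy|].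
  now exists q, c.
Qed.

(** A proposition that ignores the environment is classically true or false, so a constant formula
    defines it whatever its content. *)
Lemma definable_const P : definable (fun _ => P).
Proof.
  destruct (classic P) as [H|H].
  - exists (Imp Bot Bot), (fun _ => point). simpl. tauto.
  - exists Bot, (fun _ => point). simpl. tauto.
Qed.

Lemma definable_imp P Q : definable P -> definable Q ->
  definable (fun r => P r -> Q r).
Proof.
  intros [p [c H]] [q [d K]].
  destruct (definable_reindex P p c (merge c d) (fun k => k) (fun k => 2 * k) H)
    as [p' H']; [intros k; now rewrite merge_even|].
  destruct (definable_reindex Q q d (merge c d) (fun k => k)
    (fun k => S (2 * k)) K) as [q' K']; [intros k; now rewrite merge_odd|].
  exists (Imp p' q'), (merge c d). intros r. simpl.
  rewrite <- H', <- K'. reflexivity.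
Qed.

Lemma definable_not P : definable P -> definable (fun r => ~ P r).
Proof. intros H. apply (definable_imp P); [exact H|apply definable_const]. Qed.

Lemma definable_and P Q : definable P -> definable Q ->
  definable (fun r => P r /\ Q r).
Proof.
  intros H K. apply (definable_ext (fun r => ~ (P r -> ~ Q r))).
  - intros r. tauto.
  - apply definable_not, definable_imp, definable_not; assumption.
Qed.

Lemma definable_or P Q : definable P -> definable Q ->
  definable (fun r => P r \/ Q r).
Proof.
  intros H K. apply (definable_ext (fun r => ~ P r -> Q r)).
  - intros r. tauto.
  - apply definable_imp; [apply definable_not|]; assumption.
Qed.

Lemma definable_iff P Q : definable P -> definable Q ->
  definable (fun r => P r <-> Q r).
Proof. intros H K. apply definable_and; apply definable_imp; assumption. Qed.

Lemma definable_all (P : env -> M -> Prop) :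
  definable (fun r => P (fun k => r (S k)) (r 0)) ->
  definable (fun r => forall x, P r x).
Proof.
  intros [p [c H]].
  (* Under the new quantifier, index 0 is [x] and index [S m] is position [m] of [merge r c]. Hence
     variable [S k] moves from [2 * S k] to [S (2 * k)], and a parameter at an odd index moves up by
     one. *)
  set (t k := if Nat.odd k then S k else pred k).
  exists (All (rename t p)), c. intros r. simpl.
  enough (K : forall x, P r x <-> sat mem (scons x (merge r c)) (rename t p))
    by (split; intros L x; apply K, L).
  intros x. specialize (H (scons x r)). simpl in H.
  change (fun k => r k) with r in H. rewrite H, sat_rename.
  apply sat_ext. intros n _. revert n. apply even_odd_cases; intros k; unfold t.
  - rewrite merge_even, odd_double. destruct k as [|k]; [easy|].
    replace (pred (2 * S k)) with (S (2 * k)) by lia. cbn [scons].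
    now rewrite merge_even.
  - rewrite merge_odd, odd_succ_double. cbn [scons].
    now rewrite merge_odd.
Qed.

Lemma definable_ex (P : env -> M -> Prop) :
  definable (fun r => P (fun k => r (S k)) (r 0)) ->
  definable (fun r => exists x, P r x).
Proof.
  intros H. apply (definable_ext (fun r => ~ forall x, ~ P r x)).
  - intros r. split.
    + intros K. apply NNPP. intros L. apply K. intros x Hx. eauto.
    + intros [x Hx] K. exact (K x Hx).
  - apply definable_not, (definable_all (fun r x => ~ P r x)), definable_not, H.
Qed.

Definition definable_term (u : env -> M) : Prop :=
  definable (fun r => r 0 = u (fun k => r (S k))).

Lemma definable_term_rename u (s : nat -> nat) :
  definable_term u -> definable_term (fun r => u (fun k => r (s k))).
Proof.
  intros H. exact (definable_rename _ (up s) H).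
Qed.

(** Terms are Rocq functions without syntax, so substitution is expressed by quantifying over the
    value of the term. *)
Lemma definable_app (P : M -> Prop) u :
  definable (fun r => P (r 0)) -> definable_term u ->
  definable (fun r => P (u r)).
Proof.
  intros H K. apply (definable_ext (fun r => exists x, x = u r /\ P x)).
  - intros r. split; [intros [x [-> Hx]]; exact Hx|eauto].
  - apply (definable_ex (fun r x => x = u r /\ P x)), definable_and; assumption.
Qed.

Lemma definable_app2 (P : M -> M -> Prop) u v :
  definable (fun r => P (r 0) (r 1)) -> definable_term u -> definable_term v ->
  definable (fun r => P (u r) (v r)).
Proof.
  intros H Hu Hv.
  apply (definable_ext (fun r => exists x, x = u r /\ P x (v r))).
  - intros r. split; [intros [x [-> Hx]]; exact Hx|eauto].
  - apply (definable_ex (fun r x => x = u r /\ P x (v r))), definable_and;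
      [exact Hu|].
    apply (definable_ext (fun r => exists y, y = v (fun k => r (S k)) /\ P (r 0) y)).
    + intros r. split; [intros [x [-> Hx]]; exact Hx|eauto].
    + apply (definable_ex (fun r y => y = v (fun k => r (S k)) /\ P (r 0) y)).
      apply definable_and; [exact (definable_term_rename v S Hv)|].
      exact (definable_rename _ (fun k => match k with 0 => 1 | _ => 0 end) H).
Qed.

Lemma definable_term_app (F : M -> M) u :
  definable_term (fun r => F (r 0)) -> definable_term u ->
  definable_term (fun r => F (u r)).
Proof.
  intros H K. unfold definable_term in *.
  apply (definable_ext (fun r =>
    exists x, x = u (fun k => r (S k)) /\ r 0 = F x)).
  - intros r. split; [intros [x [-> Hx]]; exact Hx|eauto].
  - apply (definable_ex (fun r x => x = u (fun k => r (S k)) /\ r 0 = F x)).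
    apply definable_and.
    + exact (definable_term_rename u S K).
    + apply (definable_rename (fun r => r 0 = F (r 1))
        (fun k => match k with 0 => 1 | _ => 0 end) H).
Qed.

Lemma definable_eq_var i j : definable (fun r => r i = r j).
Proof.
  exists (Eq (2 * i) (2 * j)), (fun _ => point). intros r.
  cbn -[Nat.mul]. now rewrite !merge_even.
Qed.

Lemma definable_mem_var i j : definable (fun r => r i ∈ r j).
Proof.
  exists (Mem (2 * i) (2 * j)), (fun _ => point). intros r.
  cbn -[Nat.mul]. now rewrite !merge_even.
Qed.

Lemma definable_term_var i : definable_term (fun r => r i).
Proof. apply (definable_eq_var 0 (S i)). Qed.

Lemma definable_term_const c : definable_term (fun _ => c).
Proof.
  exists (Eq (2 * 0) (S (2 * 0))), (fun _ => c). intros r.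
  cbn -[Nat.mul]. now rewrite merge_even, merge_odd.
Qed.

Lemma definable_mem u v : definable_term u -> definable_term v ->
  definable (fun r => u r ∈ v r).
Proof.
  intros H K.
  apply (definable_ext (fun r => exists x, x = u r /\ exists y, y = v r /\ x ∈ y)).
  - intros r. split; [intros [x [-> [y [-> Hx]]]]; exact Hx|eauto].
  - apply (definable_ex (fun r x => x = u r /\ exists y, y = v r /\ x ∈ y)).
    apply definable_and; [exact H|].
    apply (definable_ex (fun r y => y = v (fun k => r (S k)) /\ r 0 ∈ y)).
    apply definable_and; [exact (definable_term_rename v S K)|].
    apply definable_mem_var.
Qed.

Lemma definable_eq u v : definable_term u -> definable_term v ->
  definable (fun r => u r = v r).
Proof.
  intros H K.
  apply (definable_ext (fun r => exists x, x = u r /\ x = v r)).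
  - intros r. split; [intros [x [-> Hx]]; exact Hx|eauto].
  - apply (definable_ex (fun r x => x = u r /\ x = v r)).
    apply definable_and; assumption.
Qed.

(** Turns every variable but the first into a parameter, as separation at a fixed environment
    requires: [merge e c] becomes the new parameter environment, and [t] translates the
    addresses. *)
Lemma definable_fix (P : env -> Prop) (e : env) :
  definable P -> definable (fun r => P (scons (r 0) e)).
Proof.
  intros [p [c H]].
  set (t k := if Nat.odd k then S (2 * S (2 * Nat.div2 k)) else
                match k with 0 => 0 | _ => S (2 * (2 * pred (Nat.div2 k))) end).
  exists (rename t p), (merge e c). intros r. rewrite sat_rename, H.
  apply sat_ext. intros n _. revert n. apply even_odd_cases; intros k; unfold t.
  - rewrite merge_even, odd_double, Nat.div2_double.
    destruct k as [|k]; [easy|]. cbn [scons].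
    replace (2 * S k) with (S (S (2 * k))) by lia. cbn [pred].
    now rewrite merge_odd, merge_even.
  - now rewrite merge_odd, odd_succ_double, Nat.div2_succ_double, !merge_odd.
Qed.

End Definability.

Create HintDb def.

Ltac def_shift :=
  match goal with
  | |- definable_term (fun r => ?u (fun k => r (@?s k))) =>
      apply (definable_term_rename u s); assumption
  | |- definable_term (fun r => ?u r) => assumption
  end.

#[local] Hint Extern 1 (definable_term _) => def_shift : def.
(** Handles operations and predicates whose definability is only a hypothesis in the context. *)
Ltac def_app :=
  match goal with
  | H : definable_term (fun r => ?F (r 0)) |- definable_term (fun r => ?F _) =>
      apply (definable_term_app F _ H); cbv beta
  | H : definable (fun r => ?P (r 0) (r 1)) |- definable (fun r => ?P _ _) =>
      apply (definable_app2 P _ _ H); cbv beta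
  | H : definable (fun r => ?P (r 0)) |- definable (fun r => ?P _) =>
      apply (definable_app P _ H); cbv beta
  end.

#[local] Hint Extern 2 (definable_term _) => def_app : def.
#[local] Hint Extern 2 (definable _) => def_app : def.
#[local] Hint Extern 1 (definable_term _) =>
  apply definable_term_const : def.
#[local] Hint Extern 1 (definable_term _) => apply definable_term_var : def.
#[local] Hint Extern 1 (definable (fun _ => _)) =>
  apply definable_const : def.
#[local] Hint Extern 2 (definable (fun r => forall x, _)) =>
  first [apply definable_imp; cbv beta | apply definable_all; cbv beta] : def.
#[local] Hint Extern 2 (definable (fun r => ex _)) =>
  apply definable_ex; cbv beta : def.
#[local] Hint Extern 2 (definable (fun r => _ /\ _)) =>
  apply definable_and; cbv beta : def.
#[local] Hint Extern 2 (definable (fun r => _ \/ _)) =>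
  apply definable_or; cbv beta : def.
#[local] Hint Extern 2 (definable (fun r => _ <-> _)) =>
  apply definable_iff; cbv beta : def.
#[local] Hint Extern 2 (definable (fun r => ~ _)) =>
  apply definable_not; cbv beta : def.
#[local] Hint Extern 2 (definable (fun r => mem _ _)) =>
  apply definable_mem; cbv beta : def.
#[local] Hint Extern 2 (definable (fun r => _ = _)) =>
  apply definable_eq; cbv beta : def.

Ltac def := cbv beta; solve [auto 200 with def].

(** * Set theory in a model of ZFC *)

Section Sets.

Context {M : Type} {Z : zfc_model M}.

Notation env := (nat -> M).

Lemma zfc_interp p (e : env) : ZFC p -> interp mem e p.
Proof. intros H. apply interp_sat, zfc_sat, H. Qed.

Lemma sat_closure p : (forall e : env, sat mem e (closure p)) ->
  forall e : env, sat mem e p.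
Proof.
  unfold closure. induction (fbound p) as [|n IH]; simpl; [easy|].
  intros H. apply IH. intros e.
  apply (sat_ext _ _ (scons (e 0) (fun k => e (S k)))); [|apply H].
  intros [|k] _; reflexivity.
Qed.

(** [interp] of the axiom computes to this statement, so the axiom proves it by conversion. *)
Lemma set_ext (a b : M) : (forall x, x ∈ a <-> x ∈ b) -> a = b.
Proof. exact (zfc_interp _ (fun _ => point) ZFC_extensionality a b). Qed.

Lemma separation_model (a : M) P : definable (fun r => P (r 0)) ->
  exists b, forall x, x ∈ b <-> x ∈ a /\ P x.
Proof.
  intros [p [c H]].
  (* [P] looks at variable 0 only, so all even positions may be read as the separated element;
     parameter [k] becomes index [S k] of the schema. *)
  set (t k := if Nat.odd k then S (Nat.div2 k) else 0).
  destruct (proj2 (interp_sat _ _ _) (sat_closure _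
    (fun e => zfc_sat _ e (ZFC_separation (rename t p))) c) a) as [b Hb].
  exists b. intros x. specialize (Hb x). cbv beta in Hb.
  (* The quantifiers for [a], [b] and [x] make the depth 3, where [x] has index 0 and parameter [k]
     has index [3 + k]. *)
  assert (K : interp mem (scons x (scons b (scons a c)))
    (schema1 (rename t p) (fun d => d - 3) 3) <-> P x).
  { rewrite interp_sat. unfold schema1. rewrite !sat_rename.
    rewrite (H (fun _ => x)). apply sat_ext. intros n _. revert n.
    apply even_odd_cases; intros k; unfold t.
    - now rewrite odd_double, merge_even.
    - now rewrite odd_succ_double, merge_odd, Nat.div2_succ_double. }
  rewrite <- K. exact Hb.
Qed.

Definition set_of (P : M -> Prop) : M :=
  epsilon (inhabits point) (fun b => forall x, x ∈ b <-> P x).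

Lemma set_of_spec P : (exists b, forall x, x ∈ b <-> P x) ->
  forall x, x ∈ set_of P <-> P x.
Proof. exact (epsilon_spec _ (fun b => forall x, x ∈ b <-> P x)). Qed.

(** Although [set_of] is obtained from [epsilon], extensionality makes its value the only set with
    these elements, so its graph is definable. *)
Lemma definable_set_of (P : env -> M -> Prop) :
  (forall r, exists b, forall x, x ∈ b <-> P r x) ->
  definable (fun r => P (fun k => r (S k)) (r 0)) ->
  definable_term (fun r => set_of (P r)).
Proof.
  intros H K.
  apply (definable_ext (fun r =>
    forall x, x ∈ r 0 <-> P (fun k => r (S k)) x)).
  - intros r. pose proof (set_of_spec _ (H (fun k => r (S k)))) as L. split.
    + intros E. apply set_ext. intros x. rewrite E, L. reflexivity.
    + intros ->. exact L.
  - apply definable_all. apply definable_iff; [def|].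
    exact (definable_rename _ (fun k => match k with 0 => 0 | S k => S (S k) end)
      K).
Qed.

Definition sep (a : M) (P : M -> Prop) : M := set_of (fun x => x ∈ a /\ P x).

Lemma sep_spec a P : definable (fun r => P (r 0)) ->
  forall x, x ∈ sep a P <-> x ∈ a /\ P x.
Proof. intros H. apply set_of_spec, separation_model, H. Qed.

Lemma definable_sep a (P : env -> M -> Prop) : definable_term a ->
  definable (fun r => P (fun k => r (S k)) (r 0)) ->
  definable_term (fun r => sep (a r) (P r)).
Proof.
  intros H K. apply (definable_set_of (fun r x => x ∈ a r /\ P r x)).
  - intros r. apply separation_model. exact (definable_fix _ r K).
  - apply definable_and; [def|exact K].
Qed.

Definition upair (a b : M) : M := set_of (fun x => x = a \/ x = b).

Lemma upair_exists (a b : M) : exists p, forall x, x ∈ p <-> x = a \/ x = b.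
Proof.
  destruct (zfc_interp _ (fun _ => point) ZFC_pairing a b) as [p Hp].
  (* [Or] is an implication from a negation and [interp] leaves it so; the return to a disjunction
     is classical. *)
  exists p. intros x. destruct (Hp x) as [H K]. simpl in H, K.
  split; [|intros [E|E]; apply K; tauto].
  intros L. destruct (classic (x = a)); auto.
Qed.

Lemma upair_spec a b x : x ∈ upair a b <-> x = a \/ x = b.
Proof. apply set_of_spec, upair_exists. Qed.

Lemma definable_upair u v : definable_term u -> definable_term v ->
  definable_term (fun r => upair (u r) (v r)).
Proof.
  intros H K. apply (definable_set_of (fun r x => x = u r \/ x = v r)).
  - intros r. apply upair_exists.
  - def.
Qed.

Definition bigcup (a : M) : M := set_of (fun x => exists y, y ∈ a /\ x ∈ y).

Lemma bigcup_exists (a : M) :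
  exists u, forall x, x ∈ u <-> exists y, y ∈ a /\ x ∈ y.
Proof. exact (zfc_interp _ (fun _ => point) ZFC_union a). Qed.

Lemma bigcup_spec a x : x ∈ bigcup a <-> exists y, y ∈ a /\ x ∈ y.
Proof. revert x. apply set_of_spec, bigcup_exists. Qed.

Lemma definable_bigcup u : definable_term u ->
  definable_term (fun r => bigcup (u r)).
Proof.
  intros H. apply (definable_set_of (fun r x => exists y, y ∈ u r /\ x ∈ y)).
  - intros r. apply bigcup_exists.
  - def.
Qed.

Definition sub (a b : M) : Prop := forall x, x ∈ a -> x ∈ b.

Lemma definable_sub u v : definable_term u -> definable_term v ->
  definable (fun r => sub (u r) (v r)).
Proof. intros H K. unfold sub. def. Qed.

Lemma sub_antisym a b : sub a b -> sub b a -> a = b.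
Proof. intros H K. apply set_ext. intros x. split; auto. Qed.

Lemma sub_refl a : sub a a.
Proof. intros x; auto. Qed.

Definition pow (a : M) : M := set_of (fun x => sub x a).

Lemma pow_exists (a : M) : exists b, forall x, x ∈ b <-> sub x a.
Proof. exact (zfc_interp _ (fun _ => point) ZFC_power_set a). Qed.

Lemma pow_spec a x : x ∈ pow a <-> sub x a.
Proof. revert x. apply set_of_spec, pow_exists. Qed.

Lemma definable_pow u : definable_term u ->
  definable_term (fun r => pow (u r)).
Proof.
  intros H. apply (definable_set_of (fun r x => sub x (u r))).
  - intros r. apply pow_exists.
  - unfold sub. def.
Qed.

End Sets.

#[local] Hint Extern 1 (definable (fun r => sub _ _)) =>
  apply definable_sub; cbv beta : def.
#[local] Hint Extern 1 (definable_term (fun r => sep _ _)) =>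
  apply definable_sep; cbv beta : def.
#[local] Hint Extern 1 (definable_term (fun r => upair _ _)) =>
  apply definable_upair; cbv beta : def.
#[local] Hint Extern 1 (definable_term (fun r => bigcup _)) =>
  apply definable_bigcup; cbv beta : def.
#[local] Hint Extern 1 (definable_term (fun r => pow _)) =>
  apply definable_pow; cbv beta : def.

(** * Pairs, products and functions *)

Section Pairs.

Context {M : Type} {Z : zfc_model M}.

Definition empty_set : M := sep point (fun _ => False).

Lemma empty_spec x : ~ x ∈ empty_set.
Proof. unfold empty_set. rewrite sep_spec by def. tauto. Qed.

Definition cup (a b : M) : M := bigcup (upair a b).

Lemma cup_spec a b x : x ∈ cup a b <-> x ∈ a \/ x ∈ b.
Proof.
  unfold cup. rewrite bigcup_spec. split.
  - intros [y [Hy Hx]]. apply upair_spec in Hy. destruct Hy; subst; auto.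
  - intros [H|H]; eexists; rewrite upair_spec; eauto.
Qed.

Lemma definable_cup u v : definable_term u -> definable_term v ->
  definable_term (fun r => cup (u r) (v r)).
Proof. intros H K. unfold cup. def. Qed.

Definition opair (a b : M) : M := upair (upair a a) (upair a b).

Lemma definable_opair u v : definable_term u -> definable_term v ->
  definable_term (fun r => opair (u r) (v r)).
Proof. intros H K. unfold opair. def. Qed.

End Pairs.

#[local] Hint Extern 1 (definable_term (fun r => cup _ _)) =>
  apply definable_cup; cbv beta : def.
#[local] Hint Extern 1 (definable_term (fun r => opair _ _)) =>
  apply definable_opair; cbv beta : def.

Section Products.

Context {M : Type} {Z : zfc_model M}.

Lemma opair_inj (a b c d : M) : opair a b = opair c d -> a = c /\ b = d.
Proof.
  unfold opair. intros H.
  assert (S1 : forall x y z : M, upair x x = upair y z -> x = y /\ x = z).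
  { intros x y z K. split; symmetry.
    - assert (L : y ∈ upair x x) by (rewrite K, upair_spec; auto).
      apply upair_spec in L. tauto.
    - assert (L : z ∈ upair x x) by (rewrite K, upair_spec; auto).
      apply upair_spec in L. tauto. }
  assert (E1 : upair a a ∈ upair (upair c c) (upair c d))
    by (rewrite <- H, upair_spec; auto).
  assert (E : a = c).
  { apply upair_spec in E1. destruct E1 as [E1|E1]; apply S1 in E1; tauto. }
  subst c. split; [reflexivity|].
  assert (E2 : upair a b ∈ upair (upair a a) (upair a d))
    by (rewrite <- H, upair_spec; auto).
  assert (E3 : upair a d ∈ upair (upair a a) (upair a b))
    by (rewrite H, upair_spec; auto).
  apply upair_spec in E2, E3.
  destruct E2 as [E2|E2].
  - symmetry in E2. apply S1 in E2. destruct E2 as [_ <-].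
    destruct E3 as [E3|E3]; symmetry in E3; apply S1 in E3; tauto.
  - assert (K : b ∈ upair a d) by (rewrite <- E2, upair_spec; auto).
    assert (L : d ∈ upair a b) by (rewrite E2, upair_spec; auto).
    apply upair_spec in K, L. destruct K; [|assumption]. destruct L; congruence.
Qed.

Definition cart (a b : M) : M :=
  sep (pow (pow (cup a b)))
    (fun p => exists x y, x ∈ a /\ y ∈ b /\ p = opair x y).

Lemma definable_cart u v : definable_term u -> definable_term v ->
  definable_term (fun r => cart (u r) (v r)).
Proof.
  intros H K. unfold cart. def.
Qed.

Lemma cart_spec a b p :
  p ∈ cart a b <-> exists x y, x ∈ a /\ y ∈ b /\ p = opair x y.
Proof.
  unfold cart. rewrite sep_spec by def.
  split; [tauto|]. intros [x [y [Hx [Hy ->]]]]. split; [|eauto 6].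
  apply pow_spec. intros z Hz. apply pow_spec. intros t Ht.
  apply cup_spec. unfold opair in Hz. apply upair_spec in Hz.
  destruct Hz; subst z; apply upair_spec in Ht; destruct Ht; subst; auto.
Qed.

Lemma cart_opair a b x y : opair x y ∈ cart a b <-> x ∈ a /\ y ∈ b.
Proof.
  rewrite cart_spec. split; [|intros [Hx Hy]; exists x, y; auto].
  intros [x' [y' [Hx [Hy E]]]]. apply opair_inj in E.
  destruct E; subst; auto.
Qed.

End Products.

#[local] Hint Extern 1 (definable_term (fun r => cart _ _)) =>
  apply definable_cart; cbv beta : def.

Section Functions.

Context {M : Type} {Z : zfc_model M}.

Definition isfun (f a b : M) : Prop :=
  sub f (cart a b) /\
  forall x, x ∈ a -> exists y, opair x y ∈ f /\ forall z, opair x z ∈ f -> z = y.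

Lemma definable_isfun u v w :
  definable_term u -> definable_term v -> definable_term w ->
  definable (fun r => isfun (u r) (v r) (w r)).
Proof. intros H K L. unfold isfun. def. Qed.

(* A junk value unless [f] has exactly one pair with first component [x]. *)
Definition ap (f x : M) : M :=
  bigcup (sep (bigcup (bigcup f)) (fun y => opair x y ∈ f)).

Lemma definable_ap u v : definable_term u -> definable_term v ->
  definable_term (fun r => ap (u r) (v r)).
Proof. intros H K. unfold ap. def. Qed.

Lemma ap_eq f x y : opair x y ∈ f -> (forall z, opair x z ∈ f -> z = y) ->
  ap f x = y.
Proof.
  intros H K. apply set_ext. intros t. unfold ap. rewrite bigcup_spec. split.
  - intros [z [Hz Ht]]. rewrite sep_spec in Hz by def.
    rewrite (K z) in Ht; tauto.
  - intros Ht. exists y. split; [|exact Ht]. rewrite sep_spec by def.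
    (* [y] belongs to [upair x y], which belongs to [opair x y]: hence the double union in [ap]. *)
    split; [|exact H]. apply bigcup_spec. exists (upair x y).
    split; [|apply upair_spec; auto].
    apply bigcup_spec. exists (opair x y). split; [exact H|].
    apply upair_spec; auto.
Qed.

Lemma isfun_ap f a b x : isfun f a b -> x ∈ a -> opair x (ap f x) ∈ f.
Proof.
  intros [_ H] Hx. destruct (H x Hx) as [y [Hy K]].
  rewrite (ap_eq f x y); assumption.
Qed.

Lemma isfun_val f a b x y : isfun f a b -> opair x y ∈ f -> y = ap f x.
Proof.
  intros [H H'] K. assert (L := H _ K). apply cart_opair in L.
  destruct (H' x (proj1 L)) as [z [Hz Hu]].
  rewrite (ap_eq f x z); auto.
Qed.

Lemma isfun_dom f a b x y : isfun f a b -> opair x y ∈ f -> x ∈ a.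
Proof. intros [H _] K. apply H, cart_opair in K. tauto. Qed.

Lemma isfun_cod f a b x : isfun f a b -> x ∈ a -> ap f x ∈ b.
Proof.
  intros H Hx. pose proof (isfun_ap _ _ _ _ H Hx) as K.
  apply (proj1 H), cart_opair in K. tauto.
Qed.

Lemma isfun_sub f g a b c : isfun f a b -> isfun g a c ->
  (forall x, x ∈ a -> ap f x = ap g x) -> sub f g.
Proof.
  intros Hf Hg H p Hp. pose proof (proj1 Hf _ Hp) as K.
  apply cart_spec in K. destruct K as [x [y [Hx [_ ->]]]].
  rewrite (isfun_val _ _ _ _ _ Hf Hp), H by exact Hx.
  apply (isfun_ap _ _ _ _ Hg Hx).
Qed.

Lemma isfun_ext f g a b c : isfun f a b -> isfun g a c ->
  (forall x, x ∈ a -> ap f x = ap g x) -> f = g.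
Proof.
  intros Hf Hg H. apply sub_antisym.
  - eapply isfun_sub; eassumption.
  - eapply isfun_sub; [eassumption|eassumption|].
    intros x Hx. symmetry. auto.
Qed.

Definition lam (a b : M) (F : M -> M) : M :=
  sep (cart a b) (fun p => exists x, x ∈ a /\ p = opair x (F x)).

Lemma lam_spec a b F x y : definable_term (fun r => F (r 0)) ->
  opair x y ∈ lam a b F <-> x ∈ a /\ y ∈ b /\ y = F x.
Proof.
  intros D. unfold lam. rewrite sep_spec by def. rewrite cart_opair. split.
  - intros [[Hx Hy] [t [Ht E]]]. apply opair_inj in E. destruct E; subst; auto.
  - intros [Hx [Hy ->]]. eauto.
Qed.

Lemma lam_isfun a b F : definable_term (fun r => F (r 0)) ->
  (forall x, x ∈ a -> F x ∈ b) -> isfun (lam a b F) a b.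
Proof.
  intros D H. split.
  - intros p. unfold lam. rewrite sep_spec by def. tauto.
  - intros x Hx. exists (F x). rewrite lam_spec by exact D.
    split; [auto|]. intros z. rewrite lam_spec by exact D. tauto.
Qed.

Lemma lam_ap a b F x : definable_term (fun r => F (r 0)) ->
  (forall x, x ∈ a -> F x ∈ b) -> x ∈ a -> ap (lam a b F) x = F x.
Proof.
  intros D H Hx. symmetry. apply (isfun_val _ a b); [apply lam_isfun; auto|].
  rewrite lam_spec by exact D. auto.
Qed.

(** As the values lie in a given set [b], separation from [cart a b] turns the definable relation
    into a function of the model. *)
Lemma isfun_graph a b (P : M -> M -> Prop) :
  definable (fun r => P (r 0) (r 1)) ->
  (forall x, x ∈ a -> exists y, y ∈ b /\ P x y /\ forall z, z ∈ b -> P x z -> z = y)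
  -> exists f, isfun f a b /\ forall x, x ∈ a -> P x (ap f x).
Proof.
  intros D H.
  assert (D' : definable (fun r => exists x y, r 0 = opair x y /\ P x y)).
  { def. }
  set (f := sep (cart a b) (fun p => exists x y, p = opair x y /\ P x y)).
  assert (Hf : forall x y, opair x y ∈ f <-> x ∈ a /\ y ∈ b /\ P x y).
  { intros x y. unfold f. rewrite sep_spec by exact D'. rewrite cart_opair.
    split.
    - intros [[Hx Hy] [x' [y' [E K]]]]. apply opair_inj in E.
      destruct E; subst; auto.
    - intros [Hx [Hy K]]. split; [auto|]. eauto. }
  assert (F : isfun f a b).
  { split.
    - intros p Hp. unfold f in Hp. rewrite sep_spec in Hp by exact D'. tauto.
    - intros x Hx. destruct (H x Hx) as [y [Hy [K U]]]. exists y.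
      rewrite Hf. split; [auto|]. intros z. rewrite Hf. intros [_ [Hz L]].
      auto. }
  exists f. split; [exact F|]. intros x Hx.
  pose proof (isfun_ap _ _ _ _ F Hx) as K. apply Hf in K. tauto.
Qed.

End Functions.

#[local] Hint Extern 1 (definable (fun r => isfun _ _ _)) =>
  apply definable_isfun; cbv beta : def.
#[local] Hint Extern 1 (definable_term (fun r => ap _ _)) =>
  apply definable_ap; cbv beta : def.

(** * Natural numbers and recursion *)

Section Naturals.

Context {M : Type} {Z : zfc_model M}.

Definition suc (n : M) : M := cup n (upair n n).

Lemma suc_spec n x : x ∈ suc n <-> x ∈ n \/ x = n.
Proof. unfold suc. rewrite cup_spec, upair_spec. tauto. Qed.

Lemma definable_suc u : definable_term u -> definable_term (fun r => suc (u r)).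
Proof. intros H. unfold suc. def. Qed.

#[local] Hint Extern 1 (definable_term (fun r => suc _)) =>
  apply definable_suc; cbv beta : def.

Definition ind_set (i : M) : Prop :=
  empty_set ∈ i /\ forall n, n ∈ i -> suc n ∈ i.

Lemma ind_set_exists : exists i, ind_set i.
Proof.
  destruct (zfc_interp _ (fun _ => point) ZFC_infinity) as [i [H K]].
  exists i. split.
  - destruct H as [e [He H]].
    rewrite (set_ext empty_set e); [exact H|].
    intros x. split; intros Hx; [destruct (empty_spec _ Hx)|destruct (He _ Hx)].
  - intros n Hn. destruct (K n Hn) as [s [Hs L]].
    rewrite (set_ext (suc n) s); [exact L|].
    intros x. rewrite suc_spec. destruct (Hs x) as [A B]. simpl in A, B.
    split; [intros C; apply B; tauto|].
    intros C. destruct (classic (x ∈ n)); auto.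
Qed.

(** The inductive set picked by [epsilon] leaves no trace: the result is the intersection of all
    inductive sets. *)
Definition omega : M :=
  sep (epsilon (inhabits point) ind_set)
    (fun x => forall i, ind_set i -> x ∈ i).

Lemma omega_spec x : x ∈ omega <-> forall i, ind_set i -> x ∈ i.
Proof.
  unfold omega. rewrite sep_spec by (unfold ind_set; def).
  split; [tauto|]. intros H. split; [|exact H]. apply H.
  apply epsilon_spec, ind_set_exists.
Qed.

Lemma omega_zero : empty_set ∈ omega.
Proof. apply omega_spec. intros i [H _]. exact H. Qed.

Lemma omega_suc n : n ∈ omega -> suc n ∈ omega.
Proof.
  intros H. apply omega_spec. intros i Hi. apply Hi.
  apply (proj1 (omega_spec n) H i Hi).
Qed.

(** Since [omega] may have nonstandard elements, induction is available for definable [P] only: it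
    rests on the inductive set that separation provides. *)
Lemma omega_ind P : definable (fun r => P (r 0)) -> P empty_set ->
  (forall n, n ∈ omega -> P n -> P (suc n)) -> forall n, n ∈ omega -> P n.
Proof.
  intros D H0 HS n Hn.
  assert (K : n ∈ sep omega P).
  { apply (proj1 (omega_spec n) Hn). split.
    - rewrite sep_spec by def. split; [apply omega_zero|exact H0].
    - intros m. rewrite !sep_spec by def. intros [Hm K].
      split; [apply omega_suc|]; auto. }
  rewrite sep_spec in K by def. tauto.
Qed.

Lemma omega_cases n : n ∈ omega ->
  n = empty_set \/ exists m, m ∈ omega /\ n = suc m.
Proof.
  revert n. apply omega_ind; [def|auto|]. intros n Hn _. eauto.
Qed.

Lemma omega_trans n k : n ∈ omega -> k ∈ n -> k ∈ omega.
Proof.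
  intros Hn. revert k. revert n Hn.
  apply (omega_ind (fun n => forall k, k ∈ n -> k ∈ omega)); [def| |].
  - intros k Hk. destruct (empty_spec _ Hk).
  - intros n Hn IH k Hk. apply suc_spec in Hk. destruct Hk; subst; auto.
Qed.

Lemma mem_trans n k j : n ∈ omega -> k ∈ n -> j ∈ k -> j ∈ n.
Proof.
  intros Hn. revert k j. revert n Hn.
  apply (omega_ind (fun n => forall k j, k ∈ n -> j ∈ k -> j ∈ n)); [def| |].
  - intros k j Hk. destruct (empty_spec _ Hk).
  - intros n Hn IH k j Hk Hj. apply suc_spec in Hk. apply suc_spec.
    destruct Hk; subst; eauto.
Qed.

Lemma mem_irrefl n : n ∈ omega -> ~ n ∈ n.
Proof.
  revert n. apply omega_ind; [def|apply empty_spec|].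
  intros n Hn IH H. apply IH. apply suc_spec in H.
  assert (K : n ∈ suc n) by (apply suc_spec; auto).
  destruct H as [H|H]; [|congruence].
  apply (mem_trans n (suc n)); assumption.
Qed.

Lemma mem_asym n m : n ∈ omega -> m ∈ n -> ~ n ∈ m.
Proof. intros Hn H K. apply (mem_irrefl n Hn). exact (mem_trans n m n Hn H K). Qed.

Lemma zero_or_mem n : n ∈ omega -> empty_set = n \/ empty_set ∈ n.
Proof.
  revert n. apply omega_ind; [def|auto|].
  intros n Hn [IH|IH]; [subst n|]; right; apply suc_spec; auto.
Qed.

Lemma suc_mem_suc n m : n ∈ omega -> m ∈ n -> suc m ∈ suc n.
Proof.
  intros Hn. revert m. revert n Hn.
  apply (omega_ind (fun n => forall m, m ∈ n -> suc m ∈ suc n)); [def| |].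
  - intros m Hm. destruct (empty_spec _ Hm).
  - intros n Hn IH m Hm. apply suc_spec in Hm. apply suc_spec.
    destruct Hm; subst; auto.
Qed.

Lemma trichotomy n m : n ∈ omega -> m ∈ omega -> n ∈ m \/ n = m \/ m ∈ n.
Proof.
  intros Hn Hm. revert n Hn. apply omega_ind; [def| |].
  - destruct (zero_or_mem m Hm); auto.
  - intros n Hn [H|[->|H]].
    + apply (suc_mem_suc m n Hm) in H. apply suc_spec in H. tauto.
    + right; right. apply suc_spec; auto.
    + right; right. apply suc_spec; auto.
Qed.

Lemma suc_inj n m : n ∈ omega -> suc n = suc m -> n = m.
Proof.
  intros Hn H.
  assert (A : n ∈ suc m) by (rewrite <- H, suc_spec; auto).
  assert (B : m ∈ suc n) by (rewrite H, suc_spec; auto).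
  apply suc_spec in A, B. destruct A as [A|A]; [|exact A].
  destruct B as [B|B]; [|auto]. destruct (mem_asym n m Hn B A).
Qed.

Lemma suc_nonzero n : suc n <> empty_set.
Proof.
  intros H. apply (empty_spec n). rewrite <- H, suc_spec. auto.
Qed.

Lemma omega_least P n : definable (fun r => P (r 0)) -> n ∈ omega -> P n ->
  exists m, m ∈ omega /\ P m /\ forall k, k ∈ m -> ~ P k.
Proof.
  intros D Hn Pn. apply NNPP. intros C.
  assert (H : forall m, m ∈ omega -> forall k, k ∈ m -> ~ P k).
  { apply (omega_ind (fun m => forall k, k ∈ m -> ~ P k)); [def| |].
    - intros k Hk. destruct (empty_spec _ Hk).
    - intros m Hm IH k Hk. apply suc_spec in Hk.
      destruct Hk as [Hk| ->]; [auto|]. intros Pm. apply C. eauto. }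
  apply (H (suc n) (omega_suc n Hn) n); [|exact Pn].
  apply suc_spec; auto.
Qed.

(** [Q] is the least relation that contains the initial pair and is closed under [P]; induction
    shows it total and single-valued. The step is a relation, not a term, so that it can be given by
    cases. *)
Lemma recursion (X x0 : M) (P : M -> M -> M -> Prop) :
  definable (fun r => P (r 0) (r 1) (r 2)) -> x0 ∈ X ->
  (forall n x, n ∈ omega -> x ∈ X ->
     exists y, y ∈ X /\ P n x y /\ forall z, z ∈ X -> P n x z -> z = y) ->
  exists f, isfun f omega X /\ ap f empty_set = x0 /\
    forall n, n ∈ omega -> P n (ap f n) (ap f (suc n)).
Proof.
  intros D H0 HS.
  set (closed r := opair empty_set x0 ∈ r /\
    forall n x y, n ∈ omega -> x ∈ X -> y ∈ X -> P n x y ->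
      opair n x ∈ r -> opair (suc n) y ∈ r).
  set (Q n x := forall r, closed r -> opair n x ∈ r).
  assert (DP : forall i j k : nat, definable (fun r => P (r i) (r j) (r k))).
  { intros i j k. exact (definable_rename _
      (fun m => match m with 0 => i | 1 => j | _ => k end) D). }
  assert (DC : definable (fun r => closed (r 0))).
  { unfold closed. apply definable_and; [def|].
    do 3 apply definable_all. do 3 (apply definable_imp; [def|]).
    apply definable_imp; [apply DP|def]. }
  assert (DQ : definable (fun r => Q (r 0) (r 1))) by (unfold Q; def).
  assert (Q0 : Q empty_set x0) by (intros r [H _]; exact H).
  assert (QS : forall n x y, n ∈ omega -> x ∈ X -> y ∈ X -> Q n x -> P n x y ->
            Q (suc n) y).
  { intros n x y Hn Hx Hy Hq Hp r Hr. apply (proj2 Hr n x y); auto. }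
  (* Inversion for the least relation: if the pair of [m] and [x] were neither initial nor produced
     by a step, then [Q] without this pair would still be closed. *)
  assert (QI : forall m x, Q m x -> m = empty_set /\ x = x0 \/
    exists n z, n ∈ omega /\ z ∈ X /\ x ∈ X /\ m = suc n /\ Q n z /\ P n z x).
  { intros m x Hq. apply NNPP. intros C.
    set (r := sep (cart omega X) (fun p => p <> opair m x /\
      exists n x, p = opair n x /\ Q n x)).
    assert (Dr : definable (fun r => r 0 <> opair m x /\
      exists n x, r 0 = opair n x /\ Q n x)).
    { def. }
    assert (K : opair m x ∈ r).
    { apply Hq. split.
      - unfold r. rewrite sep_spec by exact Dr. rewrite cart_opair.
        split; [split; [apply omega_zero|exact H0]|]. split; [|eauto].
        intros E. apply opair_inj in E. apply C. left. intuition congruence.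
      - intros n z y Hn Hz Hy Hp. unfold r. rewrite !sep_spec by exact Dr.
        rewrite !cart_opair. intros [_ [_ [n' [z' [E Hq']]]]].
        apply opair_inj in E. destruct E as [-> ->].
        split; [split; [apply omega_suc|]; assumption|].
        split; [|exists (suc n'), y; split; [reflexivity|];
          apply (QS n' z' y); assumption].
        intros E. apply opair_inj in E. destruct E as [<- <-]. apply C. right.
        exists n', z'. auto 8. }
    unfold r in K. rewrite sep_spec in K by exact Dr. tauto. }
  assert (U : forall n, n ∈ omega -> exists y, y ∈ X /\ Q n y /\
      forall z, z ∈ X -> Q n z -> z = y).
  { apply (omega_ind (fun n => exists y, y ∈ X /\ Q n y /\
      forall z, z ∈ X -> Q n z -> z = y)).
    - def.
    - exists x0. split; [exact H0|]. split; [exact Q0|].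
      intros z _ Hz. destruct (QI _ _ Hz) as [[_ E]|[n [_ [_ [_ [_ [E _]]]]]]];
        [exact E|]. symmetry in E. destruct (suc_nonzero _ E).
    - intros n Hn [y [Hy [Hq U]]]. destruct (HS n y Hn Hy) as [z [Hz [Hp V]]].
      exists z. split; [exact Hz|]. split; [apply (QS n y z); assumption|].
      intros t Ht Hqt.
      destruct (QI _ _ Hqt) as [[E _]|[n' [s [Hn' [Hs [_ [E [Hq' Hp']]]]]]]];
        [destruct (suc_nonzero _ E)|].
      apply suc_inj in E; [|exact Hn]. subst n'. apply V; [exact Ht|].
      rewrite <- (U s Hs Hq'). exact Hp'. }
  destruct (isfun_graph omega X Q DQ U) as [f [Hf K]].
  exists f. split; [exact Hf|]. split.
  - pose proof (K _ omega_zero) as L. apply QI in L.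
    destruct L as [[_ E]|[n [_ [_ [_ [_ [E _]]]]]]]; [exact E|].
    symmetry in E. destruct (suc_nonzero _ E).
  - intros n Hn. pose proof (K _ (omega_suc n Hn)) as L. apply QI in L.
    destruct L as [[E _]|[n' [s [Hn' [Hs [_ [E [Hq' Hp']]]]]]]];
      [destruct (suc_nonzero _ E)|].
    apply suc_inj in E; [|exact Hn]. subst n'.
    destruct (U n Hn) as [y [Hy [_ V]]].
    rewrite (V _ (isfun_cod _ _ _ _ Hf Hn) (K n Hn)), <- (V s Hs Hq').
    exact Hp'.
Qed.

End Naturals.

#[local] Hint Extern 1 (definable_term (fun r => suc _)) =>
  apply definable_suc; cbv beta : def.

(* The shapes that [interp] gives to the formulas for pairs and functions. *)
Section Translation.

Context {M : Type} {Z : zfc_model M}.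

Definition pair_shape (p a b : M) : Prop :=
  forall x, (x ∈ p -> ~ x = a -> x = b) /\ ((~ x = a -> x = b) -> x ∈ p).

Definition opair_shape (p a b : M) : Prop :=
  exists s t, pair_shape s a a /\ pair_shape t a b /\ pair_shape p s t.

Definition maps_shape (f x y : M) : Prop :=
  exists p, opair_shape p x y /\ p ∈ f.

Definition isfun_shape (f a b : M) : Prop :=
  (forall p, p ∈ f -> exists x y, x ∈ a /\ y ∈ b /\ opair_shape p x y) /\
  forall x, x ∈ a ->
    exists y, maps_shape f x y /\ forall z, maps_shape f x z -> z = y.

Lemma pair_shape_iff p a b : pair_shape p a b <-> p = upair a b.
Proof.
  split.
  - intros H. apply set_ext. intros x. rewrite upair_spec.
    destruct (H x) as [K L]. destruct (classic (x = a)); tauto.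
  - intros -> x. rewrite upair_spec. tauto.
Qed.

Lemma opair_shape_iff p a b : opair_shape p a b <-> p = opair a b.
Proof.
  unfold opair_shape, opair. setoid_rewrite pair_shape_iff. split.
  - intros [s [t [-> [-> H]]]]. exact H.
  - eauto.
Qed.

(** An equation between predicates rather than an equivalence, so that one [rewrite] works under the
    binders of a translated formula. *)
Lemma maps_shape_eq : maps_shape = fun f x y => opair x y ∈ f.
Proof.
  extensionality f. extensionality x. extensionality y.
  apply propositional_extensionality. unfold maps_shape.
  setoid_rewrite opair_shape_iff. split; [intros [p [-> H]]; exact H|eauto].
Qed.

Lemma isfun_shape_eq : isfun_shape = isfun.
Proof.
  extensionality f. extensionality a. extensionality b.
  apply propositional_extensionality. unfold isfun_shape, isfun.
  rewrite maps_shape_eq. setoid_rewrite opair_shape_iff.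
  apply and_iff_compat_r. unfold sub. setoid_rewrite cart_spec. reflexivity.
Qed.

(** The axiom of choice for the nonempty subsets of [X]. The result is a set [C] of pairs, which can
    serve as a parameter in definable predicates. *)
Lemma choice_function (X : M) : exists C, forall s, sub s X ->
  (exists x, x ∈ s) ->
  exists x, x ∈ s /\ opair s x ∈ C /\ forall y, opair s y ∈ C -> y = x.
Proof.
  set (a := sep (pow X) (fun s => exists x, x ∈ s)).
  pose proof (zfc_interp _ (fun _ => point) ZFC_choice a) as H.
  change ((forall x, x ∈ a -> exists y, y ∈ x) ->
    exists f, (exists u, isfun_shape f a u) /\
      forall x, x ∈ a -> exists y, y ∈ x /\ maps_shape f x y) in H.
  rewrite isfun_shape_eq, maps_shape_eq in H.
  assert (Ha : forall s, s ∈ a <-> sub s X /\ exists x, x ∈ s).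
  { intros s. unfold a. rewrite sep_spec by def. rewrite pow_spec. tauto. }
  destruct H as [f [[u Hf] H]]; [intros x Hx; now apply Ha in Hx|].
  exists f. intros s Hs Hn. assert (K : s ∈ a) by (apply Ha; auto).
  destruct (H s K) as [y [Hy L]]. exists y. split; [exact Hy|].
  split; [exact L|]. intros z Hz.
  now rewrite (isfun_val _ _ _ _ _ Hf L), (isfun_val _ _ _ _ _ Hf Hz).
Qed.

End Translation.

(** * Bourbaki–Witt towers *)

Section Tower.

Context {M : Type} {Z : zfc_model M}.
Context (X : M) (g : M -> M).
Hypothesis g_definable : definable_term (fun r => g (r 0)).
Hypothesis g_inc : forall A, sub A X -> sub A (g A).
Hypothesis g_sub : forall A, sub A X -> sub (g A) X.

(** Unions of all subfamilies are taken, also of the empty one, so the least closed family starts at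
    the empty set. It turns out to be a chain. *)
Definition tower_closed (t : M) : Prop :=
  (forall A, A ∈ t -> g A ∈ t) /\ forall s, sub s t -> bigcup s ∈ t.

Definition tower : M :=
  sep (pow X) (fun A => forall t, tower_closed t -> A ∈ t).

Lemma tower_spec A :
  A ∈ tower <-> sub A X /\ forall t, tower_closed t -> A ∈ t.
Proof.
  unfold tower. rewrite sep_spec by (unfold tower_closed; def).
  now rewrite pow_spec.
Qed.

Lemma tower_sub A : A ∈ tower -> sub A X.
Proof. intros H. now apply tower_spec in H. Qed.

Lemma tower_succ A : A ∈ tower -> g A ∈ tower.
Proof.
  intros H. apply tower_spec in H. destruct H as [H K].
  apply tower_spec. split; [auto|]. intros t Ht. apply Ht, K, Ht.
Qed.

Lemma tower_bigcup s : sub s tower -> bigcup s ∈ tower.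
Proof.
  intros H. apply tower_spec. split.
  - intros x Hx. apply bigcup_spec in Hx. destruct Hx as [A [HA Hx]].
    apply H, tower_sub in HA. auto.
  - intros t Ht. apply Ht. intros A HA. apply H, tower_spec in HA.
    apply HA, Ht.
Qed.

Lemma tower_ind P : definable (fun r => P (r 0)) ->
  (forall A, A ∈ tower -> P A -> P (g A)) ->
  (forall s, sub s tower -> (forall A, A ∈ s -> P A) -> P (bigcup s)) ->
  forall A, A ∈ tower -> P A.
Proof.
  intros D HS HU A HA.
  assert (K : A ∈ sep tower P).
  { apply (proj1 (tower_spec A) HA). split.
    - intros B. rewrite !sep_spec by def. intros [HB K].
      split; [apply tower_succ|]; auto.
    - intros s Hs. rewrite sep_spec by def.
      assert (L : forall B, B ∈ s -> B ∈ tower /\ P B).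
      { intros B HB. apply Hs in HB. now rewrite sep_spec in HB by def. }
      split; [apply tower_bigcup; intros B HB|apply HU; [intros B HB|intros B HB]];
        apply L, HB. }
  rewrite sep_spec in K by def. tauto.
Qed.

(** The extreme points of the usual proof of the Bourbaki-Witt theorem. *)
Definition extreme (e : M) : Prop :=
  forall A, A ∈ tower -> sub A e -> A <> e -> sub (g A) e.

(** By induction on [A]: extremeness keeps [g A] below [e] while [A] is strictly below; for a union,
    either some member is already above [g e] or all of them are below [e]. *)
Lemma extreme_split e : e ∈ tower -> extreme e ->
  forall A, A ∈ tower -> sub A e \/ sub (g e) A.
Proof.
  intros He Hx. apply tower_ind; [def| |].
  - intros A HA [H|H].
    + destruct (classic (A = e)) as [->|N]; [right; apply sub_refl|].
      left. now apply Hx.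
    + right. intros x Hx'. apply g_inc; [now apply tower_sub|]. auto.
  - intros s Hs IH.
    destruct (classic (exists A, A ∈ s /\ sub (g e) A)) as [[A [HA K]]|N].
    + right. intros x Hx'. apply bigcup_spec. eauto.
    + left. intros x Hx'. apply bigcup_spec in Hx'. destruct Hx' as [A [HA Hx']].
      destruct (IH A HA) as [K|K]; [auto|]. destruct N; eauto.
Qed.

(** In the union case some [e] in [s] contains [A]; otherwise [extreme_split] puts every member of
    [s] inside [A], and [A] would be the whole union. If [A] equals this [e], then [extreme_split]
    is applied to the union itself. *)
Lemma tower_extreme e : e ∈ tower -> extreme e.
Proof.
  revert e. apply tower_ind; [unfold extreme; def| |].
  - intros e He IH A HA H N.
    destruct (extreme_split e He IH A HA) as [K|K].
    + destruct (classic (A = e)) as [->|N']; [apply sub_refl|].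
      intros x Hx. apply g_inc; [now apply tower_sub|].
      now apply (IH A HA K N').
    + destruct N. now apply sub_antisym.
  - intros s Hs IH A HA H N.
    destruct (classic (exists e, e ∈ s /\ sub A e)) as [[e [He K]]|C].
    + destruct (classic (A = e)) as [->|N'].
      * destruct (extreme_split e HA (IH e He) (bigcup s)) as [L|L];
          [now apply tower_bigcup| |exact L].
        destruct N. now apply sub_antisym.
      * intros x Hx. apply bigcup_spec. exists e. split; [exact He|].
        now apply (IH e He A HA K N').
    + destruct N. apply sub_antisym; [exact H|]. intros x Hx.
      apply bigcup_spec in Hx. destruct Hx as [e [He Hx]].
      destruct (extreme_split e (Hs _ He) (IH e He) A HA) as [K|K];
        [destruct C; eauto|].
      apply K, g_inc; [apply tower_sub, Hs, He|exact Hx].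
Qed.

Lemma tower_step A B : A ∈ tower -> B ∈ tower -> sub A B -> A <> B ->
  sub (g A) B.
Proof. intros HA HB. now apply tower_extreme. Qed.

Lemma tower_total A B : A ∈ tower -> B ∈ tower -> sub A B \/ sub B A.
Proof.
  intros HA HB.
  destruct (extreme_split B HB (tower_extreme B HB) A HA) as [H|H]; [auto|].
  right. intros x Hx. apply H, g_inc; [now apply tower_sub|exact Hx].
Qed.

(** The union of the tower is its last member. In the applications, a fixed point of [g] means that
    nothing is left to choose. *)
Lemma tower_top : g (bigcup tower) = bigcup tower.
Proof.
  apply sub_antisym.
  - intros x Hx. apply bigcup_spec. exists (g (bigcup tower)).
    split; [|exact Hx]. apply tower_succ, tower_bigcup, sub_refl.
  - apply g_inc, tower_sub, tower_bigcup, sub_refl.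
Qed.

(** The tower is well-ordered by inclusion. The union [u] of the lower bounds of [P] is a lower
    bound; if [P] failed at [u], then [g u] would be one too, so [g] would stop at [u], and [u]
    would be the top and equal to [A0]. *)
Lemma tower_least P A0 : definable (fun r => P (r 0)) -> A0 ∈ tower -> P A0 ->
  exists A, A ∈ tower /\ P A /\ forall B, B ∈ tower -> P B -> sub A B.
Proof.
  intros D H0 P0.
  set (L := sep tower (fun A => forall B, B ∈ tower -> P B -> sub A B)).
  assert (HL : forall A, A ∈ L <->
    A ∈ tower /\ forall B, B ∈ tower -> P B -> sub A B).
  { intros A. unfold L. rewrite sep_spec by def. tauto. }
  set (u := bigcup L).
  assert (Hu : u ∈ tower) by (apply tower_bigcup; intros A HA; now apply HL in HA).
  assert (Hb : forall B, B ∈ tower -> P B -> sub u B).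
  { intros B HB PB x Hx. apply bigcup_spec in Hx. destruct Hx as [A [HA Hx]].
    apply HL in HA. now apply (proj2 HA B). }
  exists u. split; [exact Hu|]. split; [|exact Hb]. apply NNPP. intros N.
  assert (E : sub (g u) u).
  { intros x Hx. apply bigcup_spec. exists (g u). split; [|exact Hx].
    apply HL. split; [now apply tower_succ|]. intros B HB PB.
    apply tower_step; auto. congruence. }
  assert (T : forall A, A ∈ tower -> sub A u).
  { apply tower_ind; [def| |].
    - intros A HA K. destruct (classic (A = u)) as [->|N']; [exact E|].
      now apply tower_step.
    - intros s _ K x Hx. apply bigcup_spec in Hx. destruct Hx as [A [HA Hx]].
      now apply (K A). }
  apply N. rewrite (sub_antisym u A0); auto.
Qed.

End Tower.

(** * Disjoint refinements *)

Section Surjections.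

Context {M : Type} {Z : zfc_model M}.

(** A partial surjection: [F] may be undefined on parts of [a] and may take values outside [b], so
    the same [F] serves every smaller target. *)
Definition surj (a b : M) : Prop :=
  exists F, (forall x y z, opair x y ∈ F -> opair x z ∈ F -> y = z) /\
    forall y, y ∈ b -> exists x, x ∈ a /\ opair x y ∈ F.

Lemma definable_surj u v : definable_term u -> definable_term v ->
  definable (fun r => surj (u r) (v r)).
Proof. intros H K. unfold surj. def. Qed.

Lemma surj_trans a b c : surj a b -> surj b c -> surj a c.
Proof.
  intros [F [HF KF]] [G [HG KG]].
  set (H := sep (cart a c)
    (fun p => exists x y z, p = opair x z /\ opair x y ∈ F /\ opair y z ∈ G)).
  assert (HH : forall x z, opair x z ∈ H <-> x ∈ a /\ z ∈ c /\
    exists y, opair x y ∈ F /\ opair y z ∈ G).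
  { intros x z. unfold H. rewrite sep_spec by def. rewrite cart_opair. split.
    - intros [[Hx Hz] [x' [y [z' [E K]]]]]. apply opair_inj in E.
      destruct E; subst. eauto.
    - intros [Hx [Hz [y K]]]. split; [auto|]. exists x, y, z. auto. }
  exists H. split.
  - intros x y z K L. apply HH in K, L.
    destruct K as [_ [_ [s [K1 K2]]]], L as [_ [_ [t [L1 L2]]]].
    rewrite (HF x s t K1 L1) in K2. eauto.
  - intros z Hz. destruct (KG z Hz) as [y [Hy K]].
    destruct (KF y Hy) as [x [Hx L]]. exists x. split; [exact Hx|].
    apply HH. eauto.
Qed.

Lemma surj_sub a b c : surj a b -> sub c b -> surj a c.
Proof. intros [F [H K]] S. exists F. auto. Qed.

Lemma surj_refl a : surj a a.
Proof.
  set (F := sep (cart a a) (fun p => exists x, p = opair x x)).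
  assert (HF : forall x y, opair x y ∈ F <-> x ∈ a /\ y ∈ a /\ x = y).
  { intros x y. unfold F. rewrite sep_spec by def. rewrite cart_opair. split.
    - intros [H [z E]]. apply opair_inj in E. destruct E; subst; tauto.
    - intros [H [K ->]]. eauto. }
  exists F. split.
  - intros x y z H K. apply HF in H, K. intuition congruence.
  - intros y Hy. exists y. rewrite HF. auto.
Qed.

Lemma surj_isfun a b b0 : b0 ∈ b -> surj a b ->
  exists e, isfun e a b /\ forall y, y ∈ b -> exists x, x ∈ a /\ ap e x = y.
Proof.
  intros Hb [F [HF KF]].
  destruct (isfun_graph a b (fun x y => opair x y ∈ F \/
    (~ exists z, z ∈ b /\ opair x z ∈ F) /\ y = b0)) as [e [He K]].
  - def.
  - intros x Hx. destruct (classic (exists z, z ∈ b /\ opair x z ∈ F))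
      as [[y [Hy L]]|N].
    + exists y. split; [exact Hy|]. split; [auto|]. intros z Hz [H|[H _]].
      * eauto.
      * destruct H; eauto.
    + exists b0. split; [exact Hb|]. split; [auto|]. intros z Hz [H|[_ H]].
      * destruct N; eauto.
      * exact H.
  - exists e. split; [exact He|]. intros y Hy.
    destruct (KF y Hy) as [x [Hx L]]. exists x. split; [exact Hx|].
    destruct (K x Hx) as [H|[H _]]; [eauto|]. destruct H; eauto.
Qed.

End Surjections.

#[local] Hint Extern 1 (definable (fun r => surj _ _)) =>
  apply definable_surj; cbv beta : def.

Section Refinement.

Context {M : Type} {Z : zfc_model M}.

Definition diff (a b : M) : M := sep a (fun x => ~ x ∈ b).

Lemma diff_spec a b x : x ∈ diff a b <-> x ∈ a /\ ~ x ∈ b.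
Proof. unfold diff. rewrite sep_spec by def. reflexivity. Qed.

Lemma definable_diff u v : definable_term u -> definable_term v ->
  definable_term (fun r => diff (u r) (v r)).
Proof. intros H K. unfold diff. def. Qed.

#[local] Hint Extern 1 (definable_term (fun r => diff _ _)) =>
  apply definable_diff; cbv beta : def.

Definition dom (W p : M) : M := sep W (fun a => exists x, opair a x ∈ p).

Lemma dom_spec W p a : a ∈ dom W p <-> a ∈ W /\ exists x, opair a x ∈ p.
Proof. unfold dom. rewrite sep_spec by def. reflexivity. Qed.

Lemma definable_dom u v : definable_term u -> definable_term v ->
  definable_term (fun r => dom (u r) (v r)).
Proof. intros H K. unfold dom. def. Qed.

#[local] Hint Extern 1 (definable_term (fun r => dom _ _)) =>
  apply definable_dom; cbv beta : def.

(* [W] is well-ordered by a tower, and [A] is its least member that maps onto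
   [W]: then no proper initial segment of [A] maps onto any of the sets [K w],
   so that distinct elements can be chosen along [A]. *)
Lemma disjoint_refinement (W X : M) (K : M -> M) :
  definable_term (fun r => K (r 0)) ->
  (forall w, w ∈ W -> sub (K w) X) ->
  (forall w, w ∈ W -> surj (K w) W) ->
  exists q, (forall w, w ∈ W -> exists x, x ∈ K w /\ opair w x ∈ q) /\
    (forall w x, opair w x ∈ q -> w ∈ W /\ x ∈ K w) /\
    (forall w w' x, opair w x ∈ q -> opair w' x ∈ q -> w = w').
Proof.
  intros DK HKX HKs.
  destruct (classic (exists w, w ∈ W)) as [[w0 Hw0]|N].
  2:{ exists empty_set. split; [intros w Hw; destruct N; eauto|].
      split; intros *; intros H; destruct (empty_spec _ H). }
  destruct (choice_function W) as [C1 HC1].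
  destruct (choice_function X) as [C2 HC2].
  (* [g1] adds the chosen element of the complement, so the tower [T1] enumerates [W] one element at
     a time. *)
  set (g1 A := sep W (fun a => a ∈ A \/
    a ∈ diff W A /\ opair (diff W A) a ∈ C1)).
  assert (Dg1 : definable_term (fun r => g1 (r 0))) by (unfold g1; def).
  assert (g1_spec : forall A a, a ∈ g1 A <-> a ∈ W /\ (a ∈ A \/
    a ∈ diff W A /\ opair (diff W A) a ∈ C1)).
  { intros A a. unfold g1. rewrite sep_spec by def. reflexivity. }
  assert (g1_inc : forall A, sub A W -> sub A (g1 A)).
  { intros A HA a Ha. apply g1_spec. auto. }
  assert (g1_sub : forall A, sub A W -> sub (g1 A) W).
  { intros A HA a Ha. apply g1_spec in Ha. tauto. }
  assert (next1 : forall A, sub A W -> A <> W ->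
    exists a, a ∈ diff W A /\ opair (diff W A) a ∈ C1).
  { intros A HA NA. destruct (HC1 (diff W A)) as [a [Ha [L _]]]; [| |eauto].
    - intros x Hx. now apply diff_spec in Hx.
    - apply NNPP. intros N. apply NA. apply sub_antisym; [exact HA|].
      intros x Hx. apply NNPP. intros Hn. apply N. exists x.
      apply diff_spec. auto. }
  assert (uniq1 : forall A a b, opair (diff W A) a ∈ C1 ->
    opair (diff W A) b ∈ C1 -> a ∈ diff W A -> a = b).
  { intros A a b Ha Hb Hd.
    destruct (HC1 (diff W A)) as [c [_ [_ U]]];
      [intros x Hx; now apply diff_spec in Hx|eauto|].
    now rewrite (U a Ha), (U b Hb). }
  set (T1 := tower W g1).
  assert (topW : bigcup T1 = W).
  { assert (S : sub (bigcup T1) W)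
      by (apply (tower_sub W g1), tower_bigcup; [auto..|apply sub_refl]).
    apply NNPP. intros N. destruct (next1 _ S N) as [a [Ha L]].
    pose proof Ha as Ha'. apply diff_spec in Ha'. apply (proj2 Ha').
    unfold T1 at 1. rewrite <- (tower_top W g1) by auto. apply g1_spec. tauto. }
  assert (HW : bigcup T1 ∈ T1) by (apply tower_bigcup; [auto..|apply sub_refl]).
  rewrite topW in HW.
  destruct (tower_least W g1 Dg1 g1_inc g1_sub (fun A => surj A W) W)
    as [A [HA [HAs HAl]]]; [def|exact HW|apply surj_refl|].
  fold T1 in HA, HAl.
  (* Stage [a] of the construction chooses a point for [ap e a]. Every [w] is served at some stage,
     possibly at several. *)
  destruct (surj_isfun A W w0 Hw0 HAs) as [e [He Hes]].
  assert (AW : sub A W) by (apply (tower_sub W g1 Dg1 A HA)).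
  set (avail p a := sep (K (ap e a)) (fun x => ~ exists b, opair b x ∈ p)).
  assert (avail_spec : forall p a x, x ∈ avail p a <->
    x ∈ K (ap e a) /\ ~ exists b, opair b x ∈ p).
  { intros p a x. unfold avail. rewrite sep_spec by def. reflexivity. }
  (* [a] is the next element of [W] after the domain of [p], and [x] the chosen untaken point of the
     set that [a] serves. Without such a point the construction stops. *)
  set (new p a x := a ∈ A /\ (a ∈ diff W (dom W p) /\
    opair (diff W (dom W p)) a ∈ C1) /\
    x ∈ avail p a /\ opair (avail p a) x ∈ C2).
  set (g2 p := sep (cart W X) (fun z => z ∈ p \/
    exists a x, z = opair a x /\ new p a x)).
  assert (Dg2 : definable_term (fun r => g2 (r 0)))
    by (unfold g2, new, avail; def).
  assert (g2_spec : forall p a x, sub p (cart W X) ->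
    opair a x ∈ g2 p <-> opair a x ∈ p \/ new p a x).
  { intros p a x Hp. unfold g2. rewrite sep_spec by (unfold new, avail; def).
    split.
    - intros [_ [H|[a' [x' [E H]]]]]; [auto|].
      apply opair_inj in E. destruct E as [-> ->]. auto.
    - intros [H|H]; [auto|]. split; [|eauto 6]. apply cart_opair.
      destruct H as [Ha [_ [Hx _]]]. split; [auto|].
      apply avail_spec in Hx. apply (HKX (ap e a)); [|tauto].
      apply (isfun_cod _ _ _ _ He Ha). }
  assert (g2_inc : forall p, sub p (cart W X) -> sub p (g2 p)).
  { intros p Hp z Hz. unfold g2. rewrite sep_spec by (unfold new, avail; def).
    auto. }
  assert (g2_sub : forall p, sub p (cart W X) -> sub (g2 p) (cart W X)).
  { intros p Hp z Hz. unfold g2 in Hz.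
    rewrite sep_spec in Hz by (unfold new, avail; def). tauto. }
  assert (new_uniq : forall p a x a' x', new p a x -> new p a' x' ->
    a = a' /\ x = x').
  { intros p a x a' x' [Ha [[H1 H2] [H3 H4]]] [_ [[_ K2] [_ K4]]].
    assert (E : a = a') by (apply (uniq1 (dom W p)); assumption).
    split; [exact E|]. subst a'.
    destruct (HC2 (avail p a)) as [c [_ [_ U]]];
      [|eauto|now rewrite (U x H4), (U x' K4)].
    intros y Hy. apply avail_spec in Hy. apply (HKX (ap e a)); [|tauto].
    apply (isfun_cod _ _ _ _ He Ha). }
  set (T2 := tower (cart W X) g2).
  (* [p] is an injective choice of points whose domain is an initial segment of the enumeration
     [T1], inside [A]. *)
  set (inv p := (forall a x y, opair a x ∈ p -> opair a y ∈ p -> x = y) /\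
    (forall a b x, opair a x ∈ p -> opair b x ∈ p -> a = b) /\
    (forall a x, opair a x ∈ p -> x ∈ K (ap e a)) /\
    dom W p ∈ T1 /\ sub (dom W p) A).
  assert (HI : forall p, p ∈ T2 -> inv p).
  { apply (tower_ind (cart W X) g2 Dg2 g2_sub); [unfold inv; def| |].
    - intros p Hp [I1 [I2 [I3 [I4 I5]]]].
      assert (Hps : sub p (cart W X)) by (apply (tower_sub (cart W X) g2 Dg2 p Hp)).
      assert (fresh : forall a x y, new p a x -> ~ opair a y ∈ p).
      { intros a x y [_ [[H _] _]] L. apply diff_spec in H. apply (proj2 H).
        apply dom_spec. split; [tauto|eauto]. }
      assert (fresh' : forall a b x, new p a x -> ~ opair b x ∈ p).
      { intros a b x [_ [_ [H _]]] L. apply avail_spec in H.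
        apply (proj2 H). eauto. }
      split; [|split; [|split]].
      + intros a x y H L. apply g2_spec in H, L; [|assumption..].
        destruct H as [H|H], L as [L|L]; [eauto| | |].
        * destruct (fresh _ _ _ L H).
        * destruct (fresh _ _ _ H L).
        * apply (new_uniq _ _ _ _ _ H L).
      + intros a b x H L. apply g2_spec in H, L; [|assumption..].
        destruct H as [H|H], L as [L|L]; [eauto| | |].
        * destruct (fresh' _ _ _ L H).
        * destruct (fresh' _ _ _ H L).
        * apply (new_uniq _ _ _ _ _ H L).
      + intros a x H. apply g2_spec in H; [|assumption].
        destruct H as [H|[_ [_ [H _]]]]; [auto|].
        apply avail_spec in H. tauto.
      (* A new pair moves the domain one step up in [T1]; without one the domain stays. A new [a]
         lies in [A] by definition of [new]. *)
      + destruct (classic (exists a x, new p a x)) as [[a [x Hn]]|N].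
        * assert (E : forall b, b ∈ dom W (g2 p) <-> b ∈ dom W p \/ b = a).
          { intros b. rewrite !dom_spec. split.
            - intros [Hb [y Hy]]. apply g2_spec in Hy; [|assumption].
              destruct Hy as [Hy|Hy]; [eauto|].
              right. apply (new_uniq _ _ _ _ _ Hy Hn).
            - intros [[Hb [y Hy]]|Hb].
              + split; [exact Hb|]. exists y. now apply g2_inc.
              + subst b. split; [apply AW, Hn|]. exists x.
                apply g2_spec; auto. }
          destruct Hn as [Ha [[H1 H2] _]]. split.
          -- replace (dom W (g2 p)) with (g1 (dom W p));
               [now apply tower_succ|].
             apply set_ext. intros b. rewrite E, g1_spec. split.
             ++ intros [_ [H|[H L]]]; [auto|]. right.
                now apply (uniq1 (dom W p)).
             ++ intros [H|H]; [apply dom_spec in H as H'; tauto|]. subst b.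
                split; auto.
          -- intros b Hb. apply E in Hb. destruct Hb as [Hb| ->]; auto.
        * replace (dom W (g2 p)) with (dom W p); [auto|].
          apply set_ext. intros b. rewrite !dom_spec.
          apply and_iff_compat_l. split; intros [y Hy]; exists y.
          -- now apply g2_inc.
          -- apply g2_spec in Hy; [|assumption].
             destruct Hy; [assumption|]. destruct N; eauto.
    - intros s Hs I.
      assert (two : forall z t, z ∈ bigcup s -> t ∈ bigcup s ->
        exists p, p ∈ s /\ z ∈ p /\ t ∈ p).
      { intros z t Hz Ht. apply bigcup_spec in Hz, Ht.
        destruct Hz as [p [Hp Hz]], Ht as [p' [Hp' Ht]].
        destruct (tower_total (cart W X) g2 Dg2 g2_inc g2_sub p p');
          auto; eauto. }
      split; [|split; [|split; [|split]]].
      + intros a x y H L. destruct (two _ _ H L) as [p [Hp [H' L']]].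
        apply (proj1 (I p Hp) _ _ _ H' L').
      + intros a b x H L. destruct (two _ _ H L) as [p [Hp [H' L']]].
        apply (proj1 (proj2 (I p Hp)) _ _ _ H' L').
      + intros a x H. apply bigcup_spec in H. destruct H as [p [Hp H]].
        now apply (I p Hp).
      + set (d := sep T1 (fun B => exists p, p ∈ s /\ B = dom W p)).
        replace (dom W (bigcup s)) with (bigcup d).
        * apply tower_bigcup; [auto|]. intros B HB. unfold d in HB.
          rewrite sep_spec in HB by def. tauto.
        * apply set_ext. intros a. rewrite dom_spec, bigcup_spec.
          unfold d. split.
          -- intros [B [HB Ha]]. rewrite sep_spec in HB by def.
             destruct HB as [_ [p [Hp ->]]]. apply dom_spec in Ha.
             destruct Ha as [Ha [x Hx]]. split; [exact Ha|]. exists x.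
             apply bigcup_spec. eauto.
          -- intros [Ha [x Hx]]. apply bigcup_spec in Hx.
             destruct Hx as [p [Hp Hx]]. exists (dom W p).
             rewrite sep_spec by def. rewrite dom_spec.
             split; [|eauto]. split; [|eauto]. apply (I p Hp).
      + intros a Ha. apply dom_spec in Ha. destruct Ha as [Ha [x Hx]].
        apply bigcup_spec in Hx. destruct Hx as [p [Hp Hx]].
        apply (I p Hp). apply dom_spec. eauto. }
  set (p := bigcup T2).
  assert (Hp : p ∈ T2) by (apply tower_bigcup; auto; apply sub_refl).
  assert (Hps : sub p (cart W X)) by (apply (tower_sub (cart W X) g2 Dg2 p Hp)).
  assert (topP : g2 p = p) by (apply tower_top; auto).
  destruct (HI p Hp) as [I1 [I2 [I3 [I4 I5]]]].
  (* If the construction stopped too early, the set at the next stage would be used up. Then [p]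
     maps [dom W p] onto that set, which maps onto [W], and the minimality of [A] is
     contradicted. *)
  assert (ED : dom W p = A).
  { apply NNPP. intros N.
    assert (S : sub (g1 (dom W p)) A) by (apply (tower_step W g1); auto).
    destruct (next1 (dom W p)) as [a [Ha L]].
    - intros x Hx. now apply dom_spec in Hx.
    - intros E. apply N. apply sub_antisym; [exact I5|]. now rewrite E.
    - assert (HaA : a ∈ A).
      { apply S, g1_spec. split; [|auto]. now apply diff_spec in Ha. }
      assert (Hw : ap e a ∈ W) by (apply (isfun_cod _ _ _ _ He HaA)).
      destruct (classic (exists x, x ∈ avail p a)) as [Hx|Nx].
      + destruct (HC2 (avail p a)) as [x [Hx' [Lx _]]]; [|exact Hx|].
        * intros y Hy. apply avail_spec in Hy. apply (HKX (ap e a)); tauto.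
        * assert (Hn : opair a x ∈ p).
          { rewrite <- topP. apply g2_spec; [exact Hps|]. right.
            split; [|split; [|split]]; auto. }
          apply diff_spec in Ha. apply (proj2 Ha), dom_spec. split; [tauto|].
          eauto.
      + apply N. apply sub_antisym; [exact I5|]. apply HAl; [exact I4|].
        apply (surj_trans _ (K (ap e a))); [|now apply HKs].
        exists p. split; [exact I1|]. intros x Hx. apply NNPP. intros Nb.
        apply Nx. exists x. apply avail_spec. split; [exact Hx|].
        intros [b Hb]. apply Nb. exists b. split; [|exact Hb].
        apply dom_spec. split; [|eauto]. apply Hps, cart_opair in Hb. tauto. }
  (* [e] translates stages back into elements of [W]; injectivity of [p] keeps different [w] from
     sharing a point. *)
  set (q := sep (cart W X) (fun z =>
    exists a x, z = opair (ap e a) x /\ opair a x ∈ p)).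
  assert (Hq : forall w x, opair w x ∈ q <->
    w ∈ W /\ x ∈ X /\ exists a, ap e a = w /\ opair a x ∈ p).
  { intros w x. unfold q. rewrite sep_spec by def. rewrite cart_opair. split.
    - intros [[Hw Hx] [a [x' [E H]]]]. apply opair_inj in E.
      destruct E as [-> ->]. split; [exact Hw|]. split; [exact Hx|].
      exists a. auto.
    - intros [Hw [Hx [a [E H]]]]. split; [auto|]. exists a, x. now rewrite E. }
  exists q. split; [|split].
  - intros w Hw. destruct (Hes w Hw) as [a [Ha E]].
    rewrite <- ED in Ha. apply dom_spec in Ha. destruct Ha as [Ha [x Hx]].
    exists x. assert (L := I3 _ _ Hx). rewrite E in L. split; [exact L|].
    apply Hq. split; [exact Hw|]. split; [now apply (HKX w)|]. eauto.
  - intros w x H. apply Hq in H. destruct H as [Hw [_ [a [E H]]]].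
    split; [exact Hw|]. apply I3 in H. now rewrite E in H.
  - intros w w' x H L. apply Hq in H, L.
    destruct H as [_ [_ [a [E H]]]], L as [_ [_ [b [E' L]]]].
    rewrite (I2 _ _ _ H L) in E. congruence.
Qed.

End Refinement.

#[local] Hint Extern 1 (definable_term (fun r => diff _ _)) =>
  apply definable_diff; cbv beta : def.

(** * Almost disjoint families *)

Section Finiteness.

Context {M : Type} {Z : zfc_model M}.

Definition isbij (h a b : M) : Prop :=
  isfun h a b /\
  forall y, y ∈ b -> exists x, opair x y ∈ h /\ forall z, opair z y ∈ h -> z = x.

Definition fin (a : M) : Prop := exists n h, n ∈ omega /\ isbij h n a.

Lemma definable_fin u : definable_term u -> definable (fun r => fin (u r)).
Proof. intros H. unfold fin, isbij. def. Qed.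

Lemma fin_empty s : (forall x, ~ x ∈ s) -> fin s.
Proof.
  intros H. exists empty_set, empty_set. split; [apply omega_zero|].
  split; [split|].
  - intros x Hx. destruct (empty_spec _ Hx).
  - intros x Hx. destruct (empty_spec _ Hx).
  - intros x Hx. destruct (H _ Hx).
Qed.

Lemma fin_add s t p : fin s -> ~ p ∈ s -> (forall x, x ∈ t <-> x ∈ s \/ x = p) ->
  fin t.
Proof.
  intros [n [h [Hn [Hh Hb]]]] Hp Ht.
  set (h' := cup h (upair (opair n p) (opair n p))).
  assert (Hh' : forall x y, opair x y ∈ h' <-> opair x y ∈ h \/ x = n /\ y = p).
  { intros x y. unfold h'. rewrite cup_spec, upair_spec. split.
    - intros [H|[H|H]]; [auto|apply opair_inj in H; auto..].
    - intros [H|[-> ->]]; auto. }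
  exists (suc n), h'. split; [now apply omega_suc|]. split; [split|].
  - intros z Hz. unfold h' in Hz. rewrite cup_spec, upair_spec in Hz.
    assert (E : z ∈ h \/ z = opair n p) by tauto. destruct E as [E|E].
    + apply (proj1 Hh), cart_spec in E. destruct E as [x [y [Hx [Hy ->]]]].
      apply cart_opair. rewrite suc_spec, Ht. auto.
    + subst z. apply cart_opair. rewrite suc_spec, Ht. auto.
  - intros x Hx. apply suc_spec in Hx. destruct Hx as [Hx| ->].
    + exists (ap h x). rewrite Hh'. split; [left; apply (isfun_ap _ _ _ _ Hh Hx)|].
      intros z Hz. apply Hh' in Hz. destruct Hz as [Hz|[-> _]].
      * now apply (isfun_val _ _ _ _ _ Hh).
      * destruct (mem_irrefl n Hn Hx).
    + exists p. rewrite Hh'. split; [auto|].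
      intros z Hz. apply Hh' in Hz. destruct Hz as [Hz|[_ Hz]]; [|exact Hz].
      apply (isfun_dom _ _ _ _ _ Hh) in Hz. destruct (mem_irrefl n Hn Hz).
  - intros y Hy. apply Ht in Hy. destruct Hy as [Hy| ->].
    + destruct (Hb y Hy) as [x [Hx U]]. exists x. rewrite Hh'.
      split; [auto|]. intros z Hz. apply Hh' in Hz.
      destruct Hz as [Hz|[_ ->]]; [auto|]. destruct (Hp Hy).
    + exists n. rewrite Hh'. split; [auto|].
      intros z Hz. apply Hh' in Hz. destruct Hz as [Hz|[Hz _]]; [|exact Hz].
      apply (proj1 Hh), cart_opair in Hz. destruct Hp. tauto.
Qed.

(** By induction on [n]: the pair at the last argument, if present, is removed and then put back by
    [fin_add]. *)
Lemma fin_restriction f n : n ∈ omega -> forall s,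
  (forall p, p ∈ s -> exists k, k ∈ n /\ p = opair k (ap f k)) -> fin s.
Proof.
  revert n. apply (omega_ind (fun n => forall s,
    (forall p, p ∈ s -> exists k, k ∈ n /\ p = opair k (ap f k)) -> fin s)).
  - apply definable_all, definable_imp; [def|].
    apply definable_fin, definable_term_var.
  - intros s Hs. apply fin_empty. intros x Hx.
    destruct (Hs x Hx) as [k [Hk _]]. exact (empty_spec _ Hk).
  - intros n Hn IH s Hs. set (p := opair n (ap f n)).
    destruct (classic (p ∈ s)) as [Hp|Hp].
    + apply (fin_add (diff s (upair p p)) s p).
      * apply IH. intros x Hx. apply diff_spec in Hx. destruct Hx as [Hx N].
        destruct (Hs x Hx) as [k [Hk ->]]. apply suc_spec in Hk.
        destruct Hk as [Hk| ->]; [eauto|]. destruct N. apply upair_spec. auto.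
      * rewrite diff_spec, upair_spec. tauto.
      * intros x. rewrite diff_spec, upair_spec.
        destruct (classic (x = p)) as [->|N]; tauto.
    + apply IH. intros x Hx. destruct (Hs x Hx) as [k [Hk E]].
      apply suc_spec in Hk. destruct Hk as [Hk| ->]; [eauto|].
      destruct Hp. unfold p. now rewrite <- E.
Qed.

(** Induction on [j] along the bijection [h]: [b] bounds the first coordinates of the pairs that [h]
    lists before [j]. *)
Lemma fin_bounded c : fin c ->
  exists b, b ∈ omega /\ forall x y, x ∈ omega -> opair x y ∈ c -> x ∈ b.
Proof.
  intros [n [h [Hn [Hh Hb]]]].
  assert (H : forall j, j ∈ omega -> exists b, b ∈ omega /\
    forall k x y, k ∈ j -> x ∈ omega -> opair k (opair x y) ∈ h -> x ∈ b).
  { apply (omega_ind (fun j => exists b, b ∈ omega /\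
      forall k x y, k ∈ j -> x ∈ omega -> opair k (opair x y) ∈ h -> x ∈ b));
      [def| |].
    - exists empty_set. split; [apply omega_zero|].
      intros k x y Hk. destruct (empty_spec _ Hk).
    - intros j Hj [b [Hbo IH]].
      destruct (classic (exists x y, x ∈ omega /\ opair j (opair x y) ∈ h))
        as [[x0 [y0 [Hx0 K]]]|N].
      + assert (E : forall x y, opair j (opair x y) ∈ h -> x = x0).
        { intros x y L. apply (isfun_val _ _ _ _ _ Hh) in K, L.
          rewrite <- L in K. apply opair_inj in K. symmetry. tauto. }
        destruct (trichotomy (suc x0) b (omega_suc _ Hx0) Hbo) as [L|L].
        * exists b. split; [exact Hbo|]. intros k x y Hk Hx Hp.
          apply suc_spec in Hk. destruct Hk as [Hk| ->]; [eauto|].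
          rewrite (E _ _ Hp). apply (mem_trans b (suc x0)); [assumption..|].
          apply suc_spec; auto.
        * assert (Hle : forall x, x ∈ b -> x ∈ suc x0).
          { intros x Hx. destruct L as [->|L]; [exact Hx|].
            apply (mem_trans (suc x0) b); auto using omega_suc. }
          exists (suc x0). split; [now apply omega_suc|]. intros k x y Hk Hx Hp.
          apply suc_spec in Hk. destruct Hk as [Hk| ->]; [eauto|].
          rewrite (E _ _ Hp). apply suc_spec; auto.
      + exists b. split; [exact Hbo|]. intros k x y Hk Hx Hp.
        apply suc_spec in Hk. destruct Hk as [Hk| ->]; [eauto|].
        destruct N; eauto. }
  destruct (H n Hn) as [b [Hbo K]]. exists b. split; [exact Hbo|].
  intros x y Hx Hp. destruct (Hb _ Hp) as [k [Hk _]].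
  apply (K k x y); auto. apply (isfun_dom _ _ _ _ _ Hh Hk).
Qed.

End Finiteness.

#[local] Hint Extern 1 (definable (fun r => fin _)) =>
  apply definable_fin; cbv beta : def.

Section Families.

Context {M : Type} {Z : zfc_model M}.

Definition baire : M := sep (pow (cart omega omega)) (fun f => isfun f omega omega).

Lemma baire_spec f : f ∈ baire <-> isfun f omega omega.
Proof.
  unfold baire. rewrite sep_spec by def. rewrite pow_spec.
  split; [tauto|]. intros H. split; [apply H|exact H].
Qed.

Lemma baire_cod f n : f ∈ baire -> n ∈ omega -> ap f n ∈ omega.
Proof. intros H. apply baire_spec in H. apply (isfun_cod _ _ _ _ H). Qed.

Lemma baire_ext f g : f ∈ baire -> g ∈ baire ->
  (forall n, n ∈ omega -> ap f n = ap g n) -> f = g.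
Proof.
  intros Hf Hg. apply baire_spec in Hf, Hg. apply (isfun_ext _ _ _ _ _ Hf Hg).
Qed.

Lemma baire_pair f n y : f ∈ baire ->
  opair n y ∈ f <-> n ∈ omega /\ y = ap f n.
Proof.
  intros H. apply baire_spec in H. split.
  - intros K. split; [apply (isfun_dom _ _ _ _ _ H K)|].
    apply (isfun_val _ _ _ _ _ H K).
  - intros [Hn ->]. apply (isfun_ap _ _ _ _ H Hn).
Qed.

Definition evdiff (f g : M) : Prop :=
  exists c, (forall x, x ∈ c <-> x ∈ f /\ x ∈ g) /\ fin c.

Lemma definable_evdiff u v : definable_term u -> definable_term v ->
  definable (fun r => evdiff (u r) (v r)).
Proof. intros H K. unfold evdiff. def. Qed.

#[local] Hint Extern 1 (definable (fun r => evdiff _ _)) =>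
  apply definable_evdiff; cbv beta : def.

Lemma evdiff_sym f g : evdiff f g -> evdiff g f.
Proof.
  intros [c [H K]]. exists c. split; [|exact K].
  intros x. rewrite H. tauto.
Qed.

Lemma evdiff_intro f g n : f ∈ baire -> g ∈ baire -> n ∈ omega ->
  (forall k, k ∈ omega -> ap f k = ap g k -> k ∈ n) -> evdiff f g.
Proof.
  intros Hf Hg Hn H. exists (sep f (fun x => x ∈ g)).
  assert (K : forall x, x ∈ sep f (fun x => x ∈ g) <-> x ∈ f /\ x ∈ g).
  { intros x. now rewrite sep_spec by def. }
  split; [exact K|]. apply (fin_restriction f n Hn).
  intros p Hp. apply K in Hp. destruct Hp as [Hp L].
  pose proof (proj1 (proj1 (baire_spec f) Hf) _ Hp) as E.
  apply cart_spec in E. destruct E as [k [y [_ [_ ->]]]].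
  apply baire_pair in Hp, L; [|assumption..].
  destruct Hp as [Hk E], L as [_ E']. exists k.
  split; [apply H; [exact Hk|congruence]|congruence].
Qed.

(** The difference is sought at a successor because the lemma is meant for a branch and its
    modification at 0, which agree at all successors. *)
Lemma evdiff_differ f g : f ∈ baire -> g ∈ baire -> evdiff f g ->
  exists n, n ∈ omega /\ ap f (suc n) <> ap g (suc n).
Proof.
  intros Hf Hg [c [Hc K]]. destruct (fin_bounded c K) as [b [Hb L]].
  exists b. split; [exact Hb|]. intros E.
  apply (mem_asym b (suc b) Hb); [|apply suc_spec; auto].
  apply (L (suc b) (ap f (suc b))); [now apply omega_suc|].
  apply Hc. split; apply baire_pair; auto using omega_suc.
Qed.

Definition ad (A : M) : Prop :=
  sub A baire /\ forall f g, f ∈ A /\ g ∈ A /\ ~ f = g -> evdiff f g.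

Definition mad_family (A : M) : Prop :=
  ad A /\ forall B, ad B /\ sub A B -> B = A.

(** As a tower starts at the empty set, its members record only what is added to [A0]. Each step
    adds a chosen function of [S A], if there is one; at the top [S] is empty, which is
    maximality. *)
Lemma mad_extension A0 : ad A0 -> exists A, mad_family A /\ sub A0 A.
Proof.
  intros HA0. destruct (choice_function baire) as [C HC].
  set (S A := sep baire (fun f => ~ f ∈ cup A0 A /\
    forall h, h ∈ cup A0 A -> evdiff f h)).
  assert (HS : forall A f, f ∈ S A <-> f ∈ baire /\ ~ f ∈ cup A0 A /\
    forall h, h ∈ cup A0 A -> evdiff f h).
  { intros A f. unfold S. rewrite sep_spec by def. reflexivity. }
  set (g A := sep baire (fun f => f ∈ A \/ f ∈ S A /\ opair (S A) f ∈ C)).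
  assert (Dg : definable_term (fun r => g (r 0))) by (unfold g, S; def).
  assert (Hg : forall A f, f ∈ g A <->
    f ∈ baire /\ (f ∈ A \/ f ∈ S A /\ opair (S A) f ∈ C)).
  { intros A f. unfold g. rewrite sep_spec by (unfold S; def). reflexivity. }
  assert (g_inc : forall A, sub A baire -> sub A (g A)).
  { intros A HA f Hf. apply Hg. auto. }
  assert (g_sub : forall A, sub A baire -> sub (g A) baire).
  { intros A HA f Hf. apply Hg in Hf. tauto. }
  assert (Ssub : forall A, sub (S A) baire) by (intros A f Hf; now apply HS in Hf).
  set (T := tower baire g).
  assert (HT : forall A, A ∈ T -> ad (cup A0 A)).
  { apply (tower_ind baire g Dg g_sub (fun A => ad (cup A0 A)));
      [unfold ad; def| |].
    - intros A HA [IH1 IH2].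
      assert (HA' : sub A baire) by (apply (tower_sub baire g Dg A HA)).
      assert (new : forall f, f ∈ cup A0 (g A) -> f ∈ cup A0 A \/
        f ∈ S A /\ opair (S A) f ∈ C).
      { intros f Hf. apply cup_spec in Hf. rewrite Hg in Hf.
        rewrite cup_spec. tauto. }
      split.
      + intros f Hf. destruct (new f Hf) as [H|[H _]]; [auto|].
        now apply HS in H.
      + intros f h [Hf [Hh N]].
        destruct (new f Hf) as [Kf|[Kf Lf]], (new h Hh) as [Kh|[Kh Lh]].
        * auto.
        * apply evdiff_sym. apply HS in Kh. apply (proj2 (proj2 Kh)), Kf.
        * apply HS in Kf. apply (proj2 (proj2 Kf)), Kh.
        * destruct N. destruct (HC (S A) (Ssub A)) as [x [_ [_ U]]]; [eauto|].
          rewrite (U f Lf). symmetry. auto.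
    - intros s Hs IH.
      (* The tower is a chain, so two functions of the union already occur together at one stage. *)
      assert (two : forall f h, f ∈ cup A0 (bigcup s) -> h ∈ cup A0 (bigcup s) ->
        f ∈ A0 /\ h ∈ A0 \/ exists A, A ∈ s /\ f ∈ cup A0 A /\ h ∈ cup A0 A).
      { intros f h Hf Hh. rewrite cup_spec, bigcup_spec in Hf, Hh.
        destruct Hf as [Hf|[A [HA Hf]]], Hh as [Hh|[A' [HA' Hh]]].
        - auto.
        - right. exists A'. rewrite !cup_spec. auto.
        - right. exists A. rewrite !cup_spec. auto.
        - right. destruct (tower_total baire g Dg g_inc g_sub A A') as [K|K];
            auto; [exists A'|exists A]; rewrite !cup_spec; auto. }
      split.
      + intros f Hf. destruct (two f f Hf Hf) as [[H _]|[A [HA [H _]]]].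
        * now apply HA0.
        * now apply (IH A HA).
      + intros f h [Hf [Hh N]].
        destruct (two f h Hf Hh) as [[H K]|[A [HA [H K]]]].
        * now apply HA0.
        * now apply (IH A HA). }
  set (U := bigcup T).
  assert (HU : U ∈ T) by (apply tower_bigcup; auto; apply sub_refl).
  assert (top : g U = U) by (apply tower_top; auto).
  exists (cup A0 U). split; [|intros x Hx; apply cup_spec; auto].
  split; [auto|]. intros B [[HB1 HB2] HB]. apply sub_antisym; [|exact HB].
  intros f Hf. apply NNPP. intros N.
  destruct (HC (S U) (Ssub U)) as [x [Hx [L _]]].
  - exists f. apply HS. split; [auto|]. split; [exact N|].
    intros h Hh. apply HB2. split; [exact Hf|]. split; [auto|]. congruence.
  - assert (K : x ∈ g U) by (apply Hg; split; [now apply (Ssub U)|auto]).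
    rewrite top in K. apply HS in Hx. destruct Hx as [_ [Hx _]].
    apply Hx, cup_spec. auto.
Qed.

End Families.

(** * Perfect sets of branches *)

Section Topology.

Context {M : Type} {Z : zfc_model M}.

Definition agree_below (f g n : M) : Prop :=
  forall k, k ∈ n -> exists y, opair k y ∈ f /\ opair k y ∈ g.

Definition open_set (U : M) : Prop :=
  sub U baire /\
  forall f, f ∈ U -> exists n, n ∈ omega /\
    forall g, g ∈ baire /\ agree_below f g n -> g ∈ U.

Definition closed_set (C : M) : Prop :=
  sub C baire /\
  exists U, open_set U /\ forall f, f ∈ baire -> (f ∈ C <-> ~ f ∈ U).

Definition isolated_in (P f : M) : Prop :=
  exists U, open_set U /\ forall g, (g ∈ U /\ g ∈ P) <-> g = f.

Definition perfect_set (P : M) : Prop :=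
  (exists f, f ∈ P) /\ closed_set P /\ forall f, f ∈ P -> ~ isolated_in P f.

Lemma definable_perfect u : definable_term u ->
  definable (fun r => perfect_set (u r)).
Proof.
  intros H. unfold perfect_set, isolated_in, closed_set, open_set, agree_below.
  def.
Qed.

Lemma agree_below_iff f g n : f ∈ baire -> g ∈ baire -> n ∈ omega ->
  agree_below f g n <-> forall k, k ∈ n -> ap f k = ap g k.
Proof.
  intros Hf Hg Hn. unfold agree_below. split; intros H k Hk.
  - destruct (H k Hk) as [y [K L]]. apply baire_pair in K, L; [|assumption..].
    destruct K, L. congruence.
  - exists (ap f k). rewrite !baire_pair by assumption. rewrite H by exact Hk.
    pose proof (omega_trans n k Hn Hk). auto.
Qed.

Lemma agree_below_refl f n : f ∈ baire -> n ∈ omega -> agree_below f f n.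
Proof. intros Hf Hn. now apply agree_below_iff. Qed.

Lemma ball_open f n : f ∈ baire -> n ∈ omega ->
  open_set (sep baire (fun g => agree_below f g n)).
Proof.
  intros Hf Hn.
  assert (H : forall g, g ∈ sep baire (fun g => agree_below f g n) <->
    g ∈ baire /\ agree_below f g n).
  { intros g. unfold agree_below. rewrite sep_spec by def. reflexivity. }
  split; [intros g Hg; now apply H in Hg|].
  intros g Hg. apply H in Hg. destruct Hg as [Hg K]. exists n.
  split; [exact Hn|]. intros h [Hh L]. apply H. split; [exact Hh|].
  rewrite agree_below_iff in * by assumption. intros k Hk.
  rewrite K, L; auto.
Qed.

End Topology.

#[local] Hint Extern 1 (definable (fun r => perfect_set _)) =>
  apply definable_perfect; cbv beta : def.

(** * The binary tree and its branches *)

Section Branches.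

Context {M : Type} {Z : zfc_model M}.

(* Realized by [n |-> 2n+1] and [n |-> 2n+2], with root 0. *)
Definition binary_tree (d0 d1 : M) : Prop :=
  d0 ∈ baire /\ d1 ∈ baire /\
  (forall n m, n ∈ omega -> m ∈ omega -> ap d0 n = ap d0 m -> n = m) /\
  (forall n m, n ∈ omega -> m ∈ omega -> ap d1 n = ap d1 m -> n = m) /\
  (forall n m, n ∈ omega -> m ∈ omega -> ap d0 n <> ap d1 m) /\
  forall n, n ∈ omega -> ap d0 n <> empty_set /\ ap d1 n <> empty_set.

Lemma binary_tree_exists : exists d0 d1, binary_tree d0 d1.
Proof.
  (* [2n+1] by recursion: the value at 0 is 1 and each step adds 2. The other child is the successor
     of this one. *)
  destruct (recursion omega (suc empty_set) (fun _ x y => y = suc (suc x)))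
    as [d0 [H0 [Hz Hs]]]; [def|apply omega_suc, omega_zero| |].
  { intros n x _ Hx. exists (suc (suc x)). auto using omega_suc. }
  assert (C0 : forall n, n ∈ omega -> ap d0 n ∈ omega)
    by (intros n Hn; apply (isfun_cod _ _ _ _ H0 Hn)).
  set (d1 := lam omega omega (fun n => suc (ap d0 n))).
  assert (K1 : forall n, n ∈ omega -> suc (ap d0 n) ∈ omega)
    by (intros n Hn; auto using omega_suc).
  assert (H1 : isfun d1 omega omega) by (apply lam_isfun; [def|exact K1]).
  assert (E1 : forall n, n ∈ omega -> ap d1 n = suc (ap d0 n))
    by (intros n Hn; apply (lam_ap _ _ (fun n => suc (ap d0 n))); [def|exact K1|exact Hn]).
  assert (S0 : forall n, n ∈ omega -> exists x, x ∈ omega /\ ap d0 n = suc x).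
  { intros n Hn. destruct (omega_cases n Hn) as [-> | [m [Hm ->]]].
    - rewrite Hz. eauto using omega_zero.
    - rewrite Hs by exact Hm. eauto using omega_suc. }
  assert (nz : forall n, n ∈ omega -> ap d0 n <> empty_set).
  { intros n Hn. destruct (S0 n Hn) as [x [_ ->]]. apply suc_nonzero. }
  assert (inj : forall n, n ∈ omega -> forall m, m ∈ omega ->
    ap d0 n = ap d0 m -> n = m).
  { apply (omega_ind (fun n => forall m, m ∈ omega ->
      ap d0 n = ap d0 m -> n = m)); [def| |].
    - intros m Hm E. destruct (omega_cases m Hm) as [-> | [k [Hk ->]]]; [easy|].
      rewrite Hz, Hs in E by exact Hk. apply suc_inj in E; [|apply omega_zero].
      symmetry in E. destruct (suc_nonzero _ E).
    - intros n Hn IH m Hm E. destruct (omega_cases m Hm) as [-> | [k [Hk ->]]].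
      + rewrite Hz, Hs in E by exact Hn.
        apply suc_inj in E; [|auto]. destruct (suc_nonzero _ E).
      + rewrite !Hs in E by assumption.
        apply suc_inj in E; [|auto]. apply suc_inj in E; [|auto].
        f_equal. now apply IH. }
  assert (disj : forall n, n ∈ omega -> forall m, m ∈ omega ->
    ap d0 n <> suc (ap d0 m)).
  { apply (omega_ind (fun n => forall m, m ∈ omega ->
      ap d0 n <> suc (ap d0 m))); [def| |].
    - intros m Hm E. rewrite Hz in E. apply suc_inj in E; [|apply omega_zero].
      symmetry in E. now apply nz in E.
    - intros n Hn IH m Hm E. rewrite Hs in E by exact Hn.
      apply suc_inj in E; [|auto].
      destruct (omega_cases m Hm) as [-> | [k [Hk ->]]].
      + rewrite Hz in E. apply suc_inj in E; [|auto]. now apply nz in E.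
      + rewrite Hs in E by exact Hk. apply suc_inj in E; [|auto].
        now apply (IH k). }
  exists d0, d1. unfold binary_tree. rewrite !baire_spec.
  split; [exact H0|]. split; [exact H1|]. split; [auto|]. split; [|split].
  - intros n m Hn Hm. rewrite !E1 by assumption. intros E.
    apply suc_inj in E; auto.
  - intros n m Hn Hm. rewrite E1 by assumption. auto.
  - intros n Hn. split; [auto|]. rewrite E1 by assumption. apply suc_nonzero.
Qed.

Context (d0 d1 : M).
Hypothesis tree : binary_tree d0 d1.

Definition child (u v : M) : Prop := v = ap d0 u \/ v = ap d1 u.

Lemma child_inj u u' v : u ∈ omega -> u' ∈ omega ->
  child u v -> child u' v -> u = u'.
Proof.
  destruct tree as [_ [_ [I0 [I1 [D _]]]]]. unfold child.
  intros Hu Hu' [-> | ->] [E|E]; auto.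
  - destruct (D u u' Hu Hu' E).
  - symmetry in E. destruct (D u' u Hu' Hu E).
Qed.

Lemma child_nonzero u v : u ∈ omega -> child u v -> v <> empty_set.
Proof.
  destruct tree as [_ [_ [_ [_ [_ N]]]]]. intros Hu [-> | ->]; now apply N.
Qed.

Lemma child_distinct u : u ∈ omega -> ap d0 u <> ap d1 u.
Proof. intros Hu. now apply tree. Qed.

(** A branch is the sequence of its nodes, so each value encodes all earlier ones; this is why
    branches that split never meet again. *)
Definition branches : M :=
  sep baire (fun f => ap f empty_set = empty_set /\
    forall n, n ∈ omega -> child (ap f n) (ap f (suc n))).

Lemma branches_spec f : f ∈ branches <-> f ∈ baire /\
  ap f empty_set = empty_set /\
  forall n, n ∈ omega -> child (ap f n) (ap f (suc n)).
Proof. unfold branches, child. rewrite sep_spec by def. reflexivity. Qed.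

Lemma branch_baire f : f ∈ branches -> f ∈ baire.
Proof. intros H. now apply branches_spec in H. Qed.

Lemma branch_cod f n : f ∈ branches -> n ∈ omega -> ap f n ∈ omega.
Proof. intros H. now apply baire_cod, branch_baire. Qed.

Lemma branch_zero f : f ∈ branches -> ap f empty_set = empty_set.
Proof. intros H. now apply branches_spec in H. Qed.

Lemma branch_child f n : f ∈ branches -> n ∈ omega ->
  child (ap f n) (ap f (suc n)).
Proof. intros H. apply branches_spec in H. apply H. Qed.

Lemma branch_nonzero f n : f ∈ branches -> n ∈ omega ->
  ap f (suc n) <> empty_set.
Proof.
  intros H Hn. apply (child_nonzero (ap f n)); [now apply branch_cod|].
  now apply branch_child.
Qed.

(** Parents are unique and the root is nobody's child, so both branches can be traced back in
    parallel until they reach the root together. *)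
Lemma branch_level f g n m : f ∈ branches -> g ∈ branches ->
  n ∈ omega -> m ∈ omega -> ap f n = ap g m -> n = m.
Proof.
  intros Hf Hg Hn. revert m. revert n Hn.
  apply (omega_ind (fun n => forall m, m ∈ omega -> ap f n = ap g m -> n = m));
    [def| |].
  - intros m Hm E. rewrite branch_zero in E by exact Hf.
    destruct (omega_cases m Hm) as [-> | [k [Hk ->]]]; [easy|].
    symmetry in E. destruct (branch_nonzero g k Hg Hk E).
  - intros n Hn IH m Hm E. destruct (omega_cases m Hm) as [-> | [k [Hk ->]]].
    + rewrite (branch_zero g Hg) in E. destruct (branch_nonzero f n Hf Hn E).
    + f_equal. apply IH; [exact Hk|].
      apply (child_inj _ _ (ap f (suc n)));
        [now apply branch_cod|now apply branch_cod|now apply branch_child|].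
      rewrite E. now apply branch_child.
Qed.

Lemma branch_below f g n : f ∈ branches -> g ∈ branches -> n ∈ omega ->
  ap f n = ap g n -> forall k, k ∈ n -> ap f k = ap g k.
Proof.
  intros Hf Hg. revert n. apply (omega_ind (fun n => ap f n = ap g n ->
    forall k, k ∈ n -> ap f k = ap g k)); [def| |].
  - intros _ k Hk. destruct (empty_spec _ Hk).
  - intros n Hn IH E k Hk.
    assert (E' : ap f n = ap g n).
    { apply (child_inj _ _ (ap f (suc n)));
        [now apply branch_cod|now apply branch_cod|now apply branch_child|].
      rewrite E. now apply branch_child. }
    apply suc_spec in Hk. destruct Hk as [Hk| ->]; auto.
Qed.

Lemma branch_split f g : f ∈ branches -> g ∈ branches -> f <> g ->
  exists n, n ∈ omega /\ ap f n = ap g n /\ ap f (suc n) <> ap g (suc n).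
Proof.
  intros Hf Hg N.
  assert (H : exists n, n ∈ omega /\ ap f n <> ap g n).
  { apply NNPP. intros C. apply N. apply baire_ext; [now apply branch_baire..|].
    intros n Hn. apply NNPP. intros K. apply C. eauto. }
  destruct H as [n [Hn H]].
  destruct (omega_least (fun n => ap f n <> ap g n) n) as [m [Hm [K L]]];
    [def|exact Hn|exact H|].
  destruct (omega_cases m Hm) as [-> | [k [Hk ->]]].
  - destruct K. now rewrite !branch_zero.
  - exists k. split; [exact Hk|]. split; [|exact K].
    apply NNPP, L, suc_spec. auto.
Qed.

Lemma branch_differ f g n k : f ∈ branches -> g ∈ branches -> n ∈ omega ->
  k ∈ omega -> ap f n <> ap g n -> ap f k = ap g k -> k ∈ n.
Proof.
  intros Hf Hg Hn Hk N E.
  destruct (trichotomy k n Hk Hn) as [H|[H|H]]; [exact H|congruence|].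
  destruct N. apply (branch_below f g k); assumption.
Qed.

Lemma branches_perfect : perfect_set branches.
Proof.
  split; [|split].
  - destruct (recursion omega empty_set (fun _ u v => v = ap d0 u))
      as [f [Hf [H0 HS]]]; [def|apply omega_zero| |].
    + intros n u _ Hu. exists (ap d0 u).
      split; [apply baire_cod; [apply tree|exact Hu]|auto].
    + exists f. apply branches_spec. rewrite baire_spec.
      split; [exact Hf|]. split; [exact H0|]. intros n Hn. left. auto.
  - split; [intros f; apply branch_baire|].
    exists (sep baire (fun f => ~ f ∈ branches)).
    assert (HU : forall f, f ∈ sep baire (fun f => ~ f ∈ branches) <->
      f ∈ baire /\ ~ f ∈ branches)
      by (intros f; rewrite sep_spec by def; reflexivity).
    split; [split|].
    + intros f Hf. now apply HU in Hf.
    + intros f Hf. apply HU in Hf. destruct Hf as [Hf N].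
      (* A violation shows up on finitely many values: one for the condition at the root, and those
         up to [suc n] for the child condition at [n]. *)
      assert (H : exists n, n ∈ omega /\ forall g, g ∈ baire ->
        (forall k, k ∈ n -> ap f k = ap g k) -> ~ g ∈ branches).
      { apply NNPP. intros C. apply N. apply branches_spec.
        split; [exact Hf|]. split.
        - apply NNPP. intros K. apply C. exists (suc empty_set).
          split; [apply omega_suc, omega_zero|]. intros g Hg L Hb. apply K.
          rewrite L by (apply suc_spec; auto). now apply branch_zero.
        - intros n Hn. apply NNPP. intros K. apply C. exists (suc (suc n)).
          split; [auto using omega_suc|]. intros g Hg L Hb. apply K.
          rewrite !L by (rewrite !suc_spec; auto). now apply branch_child. }
      destruct H as [n [Hn H]]. exists n. split; [exact Hn|].
      intros g [Hg K]. apply HU. split; [exact Hg|]. apply H; [exact Hg|].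
      now apply agree_below_iff.
    + intros f Hf. rewrite HU. split; [tauto|]. intros H.
      apply NNPP. tauto.
  - intros f Hf [U [[_ HU] Hi]].
    assert (HfU : f ∈ U) by now apply Hi.
    destruct (HU f HfU) as [n [Hn K]].
    (* [g] takes the other child than [f] at all levels from [n] on *)
    destruct (recursion omega empty_set (fun k u v =>
      (k ∈ n /\ v = ap f (suc k)) \/
      (~ k ∈ n /\ ap f (suc k) = ap d0 (ap f k) /\ v = ap d1 u) \/
      (~ k ∈ n /\ ap f (suc k) <> ap d0 (ap f k) /\ v = ap d0 u)))
      as [g [Hg [G0 GS]]]; [def|apply omega_zero| |].
    { intros k u Hk Hu.
      assert (A : ap d0 u ∈ omega) by (apply baire_cod; [apply tree|exact Hu]).
      assert (B : ap d1 u ∈ omega) by (apply baire_cod; [apply tree|exact Hu]).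
      destruct (classic (k ∈ n)) as [L|L];
        [|destruct (classic (ap f (suc k) = ap d0 (ap f k))) as [E|E]].
      - exists (ap f (suc k)). split; [apply branch_cod; auto using omega_suc|].
        split; [tauto|]. intros z _. tauto.
      - exists (ap d1 u). split; [exact B|]. split; [tauto|]. intros z _. tauto.
      - exists (ap d0 u). split; [exact A|]. split; [tauto|]. intros z _. tauto. }
    assert (Hgb : g ∈ baire) by now apply baire_spec.
    assert (E : forall k, k ∈ omega -> k ∈ suc n -> ap g k = ap f k).
    { intros k Hk. destruct (omega_cases k Hk) as [->|[j [Hj ->]]].
      - intros _. now rewrite G0, branch_zero.
      - intros L.
        assert (Hjn : j ∈ n).
        { apply suc_spec in L. destruct L as [L|L].
          - apply (mem_trans n (suc j)); [assumption..|]. apply suc_spec; auto.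
          - rewrite <- L. apply suc_spec; auto. }
        destruct (GS j Hj) as [[_ G]|[[G _]|[G _]]]; tauto. }
    assert (Hgb' : g ∈ branches).
    { apply branches_spec. split; [exact Hgb|]. split; [exact G0|].
      intros k Hk. destruct (GS k Hk) as [[L G]|[[_ [_ G]]|[_ [_ G]]]];
        [|right; exact G|left; exact G].
      rewrite G, (E k Hk) by (apply suc_spec; auto). now apply branch_child. }
    assert (N : g = f).
    { apply Hi. split; [|exact Hgb']. apply K. split; [exact Hgb|].
      apply agree_below_iff; [now apply branch_baire|exact Hgb|exact Hn|].
      intros k Hk. symmetry. apply E; [apply (omega_trans n k Hn Hk)|].
      apply suc_spec; auto. }
    assert (Hfn : ap f n ∈ omega) by now apply branch_cod.
    pose proof (mem_irrefl n Hn) as Nn.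
    (* At level [n] the sequence [g] turns away from [f], so [g = f] is impossible. *)
    destruct (GS n Hn) as [[L _]|[[_ [A B]]|[_ [A B]]]]; [tauto| |];
      rewrite N in B.
    + apply (child_distinct (ap f n) Hfn). congruence.
    + now apply A.
Qed.

End Branches.

(** * Coding perfect sets of branches and mapping them onto the power set of omega *)

Section PerfectSubsets.

Context {M : Type} {Z : zfc_model M}.
Context (d0 d1 : M).
Hypothesis tree : binary_tree d0 d1.

Notation branches := (branches d0 d1).

Definition nodes (Q : M) : M :=
  sep omega (fun u => exists f n, f ∈ Q /\ n ∈ omega /\ u = ap f n).

Lemma nodes_spec Q u : u ∈ nodes Q <->
  u ∈ omega /\ exists f n, f ∈ Q /\ n ∈ omega /\ u = ap f n.
Proof. unfold nodes. rewrite sep_spec by def. reflexivity. Qed.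

Context (Q : M).
Hypothesis Q_branches : sub Q branches.
Hypothesis Q_perfect : perfect_set Q.

Lemma nodes_ap f n : f ∈ Q -> n ∈ omega -> ap f n ∈ nodes Q.
Proof.
  intros Hf Hn. apply nodes_spec. split; [|eauto].
  apply (branch_cod d0 d1); auto.
Qed.

(** By closedness, a branch outside [Q] would have a neighbourhood outside [Q], fixed by its values
    below some [n]. But some [g] in [Q] passes through the node [ap f n], at level [n] by
    [branch_level], and so agrees with [f] below [n]. *)
Lemma perfect_body f : f ∈ branches ->
  (forall n, n ∈ omega -> ap f n ∈ nodes Q) -> f ∈ Q.
Proof.
  intros Hf H. apply NNPP. intros N.
  destruct Q_perfect as [_ [[_ [U [[_ HU] HQ]]] _]].
  assert (Hfb : f ∈ baire) by now apply (branch_baire d0 d1).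
  assert (Hf' : f ∈ U) by (apply NNPP; intros K; now apply N, HQ).
  destruct (HU f Hf') as [n [Hn K]].
  specialize (H n Hn). apply nodes_spec in H.
  destruct H as [_ [g [m [Hg [Hm E]]]]].
  assert (Hgb : g ∈ baire) by (apply (branch_baire d0 d1); auto).
  rewrite <- (branch_level d0 d1 tree f g n m) in E by auto.
  apply (proj1 (HQ g Hgb) Hg). apply K. split; [exact Hgb|].
  apply agree_below_iff; auto.
  apply (branch_below d0 d1 tree); auto.
Qed.

Definition splits (u : M) : Prop := ap d0 u ∈ nodes Q /\ ap d1 u ∈ nodes Q.

(** As [f] is not isolated, another member of [Q] agrees with it up to [n]; the node where the two
    part has both children in [nodes Q]. *)
Lemma perfect_splits f n : f ∈ Q -> n ∈ omega ->
  exists m, m ∈ omega /\ (n = m \/ n ∈ m) /\ splits (ap f m).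
Proof.
  intros Hf Hn. destruct Q_perfect as [_ [_ NI]].
  assert (Hfb : f ∈ baire) by (apply (branch_baire d0 d1); auto).
  (* Agreement below [suc n] includes the value at [n], so the two branches part at level [n] or
     later. *)
  set (U := sep baire (fun g => agree_below f g (suc n))).
  assert (HU : forall g, g ∈ U <-> g ∈ baire /\ agree_below f g (suc n)).
  { intros g. unfold U, agree_below. rewrite sep_spec by def. reflexivity. }
  assert (Hg : exists g, g ∈ U /\ g ∈ Q /\ g <> f).
  { apply NNPP. intros C. apply (NI f Hf). exists U.
    split; [apply ball_open; auto using omega_suc|]. intros g. split.
    - intros [Hg Hq]. apply NNPP. intros N. apply C. eauto.
    - intros ->. split; [|exact Hf]. apply HU. split; [exact Hfb|].
      apply agree_below_refl; auto using omega_suc. }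
  destruct Hg as [g [Hg [Hq N]]]. apply HU in Hg. destruct Hg as [Hgb Hg].
  rewrite agree_below_iff in Hg by auto using omega_suc.
  destruct (branch_split d0 d1 f g) as [m [Hm [E D]]]; auto.
  exists m. split; [exact Hm|]. split.
  - destruct (trichotomy n m Hn Hm) as [L|[L|L]]; auto.
    destruct D. apply Hg. now apply suc_mem_suc.
  - assert (F : ap f (suc m) ∈ nodes Q) by (apply nodes_ap; auto using omega_suc).
    assert (G : ap g (suc m) ∈ nodes Q) by (apply nodes_ap; auto using omega_suc).
    assert (CF : child d0 d1 (ap f m) (ap f (suc m)))
      by (apply branch_child; auto).
    assert (CG : child d0 d1 (ap g m) (ap g (suc m)))
      by (apply branch_child; auto).
    rewrite <- E in CG. unfold splits.
    destruct CF as [CF|CF], CG as [CG|CG]; rewrite CF in *; rewrite CG in *;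
      tauto.
Qed.

Lemma nodes_child u : u ∈ nodes Q ->
  exists v, v ∈ nodes Q /\ child d0 d1 u v.
Proof.
  intros Hu. apply nodes_spec in Hu. destruct Hu as [_ [f [n [Hf [Hn ->]]]]].
  exists (ap f (suc n)). split; [apply nodes_ap; auto using omega_suc|].
  apply branch_child; auto.
Qed.

(** [ap c n] is the number of splitting nodes that [f] passes before level [n]. *)
Definition counts (f c : M) : Prop :=
  ap c empty_set = empty_set /\ forall n, n ∈ omega ->
    (splits (ap f n) /\ ap c (suc n) = suc (ap c n) \/
     ~ splits (ap f n) /\ ap c (suc n) = ap c n).

(** From any level on, the count stays constant until the next splitting node, which exists by
    [perfect_splits]; there it grows by one. *)
Lemma counts_onto f c : f ∈ Q -> counts f c -> forall k, k ∈ omega ->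
  exists n, n ∈ omega /\ splits (ap f n) /\ ap c n = k.
Proof.
  intros Hf [C0 CS].
  assert (H : forall n, n ∈ omega ->
    exists m, m ∈ omega /\ splits (ap f m) /\ ap c m = ap c n).
  { intros n Hn. apply NNPP. intros N.
    assert (K : forall j, j ∈ omega -> n = j \/ n ∈ j -> ap c j = ap c n).
    { apply (omega_ind (fun j => n = j \/ n ∈ j -> ap c j = ap c n)); [def| |].
      - intros [->|H]; [reflexivity|]. destruct (empty_spec _ H).
      - intros j Hj IH [->|H]; [reflexivity|].
        assert (L : n = j \/ n ∈ j) by (apply suc_spec in H; tauto).
        specialize (IH L). destruct (CS j Hj) as [[S _]|[_ E]]; [|congruence].
        destruct N; eauto. }
    destruct (perfect_splits f n Hf Hn) as [m [Hm [L S]]].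
    apply N. exists m. auto. }
  apply omega_ind; [unfold splits; def| |].
  - destruct (H _ omega_zero) as [m [Hm [S E]]]. exists m. rewrite E. auto.
  - intros k Hk [n [Hn [S E]]].
    destruct (H (suc n)) as [m [Hm [S' E']]]; [auto using omega_suc|].
    exists m. split; [exact Hm|]. split; [exact S'|].
    destruct (CS n Hn) as [[_ K]|[K _]]; [congruence|contradiction].
Qed.

(* [f] takes the [d1]-branch at its [k]-th splitting node iff [k ∈ y]. *)
Definition follows (f y : M) : Prop :=
  exists c, c ∈ baire /\ counts f c /\ forall n, n ∈ omega ->
    splits (ap f n) -> (ap c n ∈ y <-> ap f (suc n) = ap d1 (ap f n)).

(** The counter is determined by [f], and [counts_onto] shows that every [k] is tested at some
    splitting node. *)
Lemma follows_inj f y y' : f ∈ Q -> sub y omega -> sub y' omega ->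
  follows f y -> follows f y' -> y = y'.
Proof.
  intros Hf Hy Hy' [c [Hc [Cc K]]] [c' [Hc' [Cc' K']]].
  assert (E : c = c').
  { apply baire_ext; [assumption..|].
    apply (omega_ind (fun n => ap c n = ap c' n)); [def| |].
    - destruct Cc, Cc'. congruence.
    - intros n Hn IH. destruct Cc as [_ S], Cc' as [_ S'].
      destruct (S n Hn), (S' n Hn); intuition congruence. }
  subst c'. apply set_ext. intros k.
  enough (H : k ∈ omega -> k ∈ y <-> k ∈ y').
  { split; intros L; apply H; auto. }
  intros Hk. destruct (counts_onto f c Hf Cc k Hk) as [n [Hn [S <-]]].
  rewrite (K n Hn S), (K' n Hn S). reflexivity.
Qed.

(** Recursion on pairs of a node and the number of splitting nodes passed so far. At splitting nodes
    [y] decides the turn; staying inside [nodes Q] ensures that the branch belongs to [Q]. *)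
Lemma follows_exists y : sub y omega -> exists f, f ∈ Q /\ follows f y.
Proof.
  intros Hy.
  set (move c u v := splits u /\ (c ∈ y /\ v = ap d1 u \/ ~ c ∈ y /\ v = ap d0 u)
    \/ ~ splits u /\ child d0 d1 u v).
  set (count c u c' := splits u /\ c' = suc c \/ ~ splits u /\ c' = c).
  set (step s t := exists u c v c', s = opair u c /\ t = opair v c' /\
    move c u v /\ count c u c').
  assert (N0 : empty_set ∈ nodes Q).
  { destruct Q_perfect as [[f Hf] _].
    rewrite <- (branch_zero d0 d1 f) by auto. apply nodes_ap; auto using omega_zero. }
  destruct (recursion (cart (nodes Q) omega) (opair empty_set empty_set)
    (fun _ s t => step s t)) as [h [Hh [H0 HS]]].
  - unfold step, move, count, splits, child. def.
  - apply cart_opair. auto using omega_zero.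
  - intros _ s _ Hs. apply cart_spec in Hs.
    destruct Hs as [u [c [Hu [Hc ->]]]].
    assert (V : exists v, v ∈ nodes Q /\ move c u v /\
      forall w, w ∈ nodes Q -> move c u w -> w = v).
    { unfold move. destruct (classic (splits u)) as [S|S].
      - destruct (classic (c ∈ y)) as [K|K]; [exists (ap d1 u)|exists (ap d0 u)];
          (split; [apply S|split; [tauto|intros w _; tauto]]).
      (* At a node that does not split, exactly one child lies in [nodes Q], so the move is
         forced. *)
      - destruct (nodes_child u Hu) as [v [Hv K]]. exists v.
        split; [exact Hv|]. split; [tauto|]. intros w Hw [[L _]|[_ L]];
          [contradiction|].
        unfold splits in S. destruct K as [K|K], L as [L|L]; subst v w; tauto. }
    assert (C : exists c', c' ∈ omega /\ count c u c' /\
      forall b, count c u b -> b = c').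
    { unfold count. destruct (classic (splits u)) as [S|S].
      - exists (suc c). split; [auto using omega_suc|].
        split; [tauto|]. intros b. tauto.
      - exists c. split; [exact Hc|]. split; [tauto|]. intros b. tauto. }
    destruct V as [v [Hv [Kv Uv]]], C as [c' [Hc' [Kc Uc]]].
    exists (opair v c'). split; [now apply cart_opair|]. split.
    + exists u, c, v, c'. auto.
    + intros t Ht [u1 [c1 [v1 [c1' [E [-> [L1 L2]]]]]]].
      apply opair_inj in E. destruct E as [<- <-].
      apply cart_opair in Ht. f_equal; [apply Uv|apply Uc]; tauto.
  - assert (HV : forall n, n ∈ omega -> exists u c, u ∈ nodes Q /\ c ∈ omega /\
      ap h n = opair u c).
    { intros n Hn. apply cart_spec, (isfun_cod _ _ _ _ Hh Hn). }
    destruct (isfun_graph omega omega (fun n u => exists c, ap h n = opair u c))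
      as [f [Hf Ff]]; [def| |].
    { intros n Hn. destruct (HV n Hn) as [u [c [Hu [Hc E]]]]. exists u.
      apply nodes_spec in Hu. split; [tauto|]. split; [eauto|].
      intros z _ [c' E']. rewrite E in E'. apply opair_inj in E'.
      symmetry. tauto. }
    destruct (isfun_graph omega omega (fun n c => exists u, ap h n = opair u c))
      as [c [Hc Fc]]; [def| |].
    { intros n Hn. destruct (HV n Hn) as [u [c [Hu [Hc E]]]]. exists c.
      split; [exact Hc|]. split; [eauto|].
      intros z _ [u' E']. rewrite E in E'. apply opair_inj in E'.
      symmetry. tauto. }
    assert (E : forall n, n ∈ omega -> ap h n = opair (ap f n) (ap c n)).
    { intros n Hn. destruct (Ff n Hn) as [c' E], (Fc n Hn) as [u' E'].
      rewrite E in *. apply opair_inj in E'. destruct E' as [_ ->]. reflexivity. }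
    assert (HM : forall n, n ∈ omega -> move (ap c n) (ap f n) (ap f (suc n)) /\
      count (ap c n) (ap f n) (ap c (suc n))).
    { intros n Hn. destruct (HS n Hn) as [u [c1 [v [c1' [E1 [E2 K]]]]]].
      rewrite E in E1, E2 by auto using omega_suc.
      apply opair_inj in E1, E2. destruct E1 as [<- <-], E2 as [<- <-]. exact K. }
    assert (Z0 : opair (ap f empty_set) (ap c empty_set) =
      opair empty_set empty_set) by (rewrite <- E; auto using omega_zero).
    apply opair_inj in Z0. destruct Z0 as [Zf Zc].
    assert (Hfb : f ∈ baire) by now apply baire_spec.
    exists f. split.
    + apply perfect_body.
      * apply branches_spec. split; [exact Hfb|]. split; [exact Zf|].
        intros n Hn. destruct (HM n Hn) as [[[_ [[_ K]|[_ K]]]|[_ K]] _];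
          [right; exact K|left; exact K|exact K].
      * intros n Hn. pose proof (isfun_cod _ _ _ _ Hh Hn) as K.
        rewrite E in K by exact Hn. now apply cart_opair in K.
    + exists c. split; [now apply baire_spec|]. split; [split; [exact Zc|]|].
      * intros n Hn. apply (HM n Hn).
      * intros n Hn S. destruct (HM n Hn) as [[[_ K]|[K _]] _];
          [|contradiction].
        split; [tauto|]. intros L. destruct K as [K|[_ K]]; [tauto|].
        rewrite L in K. symmetry in K.
        destruct (child_distinct d0 d1 tree (ap f n)); [|exact K].
        now apply baire_cod.
Qed.

Lemma perfect_surj : surj Q (pow omega).
Proof.
  set (F := sep (cart Q (pow omega))
    (fun p => exists f y, p = opair f y /\ follows f y)).
  assert (HF : forall f y, opair f y ∈ F <->
    f ∈ Q /\ sub y omega /\ follows f y).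
  { intros f y. unfold F.
    rewrite sep_spec by (unfold follows, counts, splits; def).
    rewrite cart_opair, pow_spec. split.
    - intros [[Hf Hy] [f' [y' [E K]]]]. apply opair_inj in E.
      destruct E as [-> ->]. auto.
    - intros [Hf [Hy K]]. split; [auto|]. eauto. }
  exists F. split.
  - intros f y y' H K. apply HF in H, K. destruct H as [Hf [Hy H]], K as [_ [Hy' K]].
    now apply (follows_inj f).
  - intros y Hy. apply pow_spec in Hy.
    destruct (follows_exists y Hy) as [f [Hf K]]. exists f. rewrite HF. auto.
Qed.

(** Only values at successors are tested, that is, nodes other than the root. Membership of 0 in [y]
    thus remains free to mark one of two codes. *)
Definition body (y : M) : M :=
  sep branches (fun f => forall n, n ∈ omega -> ap f (suc n) ∈ y).

Lemma body_spec y f :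
  f ∈ body y <-> f ∈ branches /\ forall n, n ∈ omega -> ap f (suc n) ∈ y.
Proof. unfold body. rewrite sep_spec by def. reflexivity. Qed.

Lemma body_nodes y : (forall u, u <> empty_set -> u ∈ y <-> u ∈ nodes Q) ->
  body y = Q.
Proof.
  intros H. apply set_ext. intros f. rewrite body_spec. split.
  - intros [Hf K]. apply perfect_body; [exact Hf|]. intros n Hn.
    destruct (omega_cases n Hn) as [-> | [m [Hm ->]]].
    + destruct Q_perfect as [[g Hg] _]. rewrite (branch_zero d0 d1 f Hf).
      rewrite <- (branch_zero d0 d1 g) by auto.
      apply nodes_ap; auto using omega_zero.
    + apply H; [now apply (branch_nonzero d0 d1)|auto].
  - intros Hf. split; [auto|]. intros n Hn. apply H.
    + apply (branch_nonzero d0 d1); auto.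
    + apply nodes_ap; auto using omega_suc.
Qed.

End PerfectSubsets.

(** * A m.a.d. family that is not s-measurable *)

Section Main.

Context {M : Type} {Z : zfc_model M}.

Lemma bernstein_set d0 d1 : binary_tree d0 d1 ->
  exists B : M, sub B (branches d0 d1) /\
    forall Q, perfect_set Q -> sub Q (branches d0 d1) ->
      (exists f, f ∈ Q /\ f ∈ B) /\ exists f, f ∈ Q /\ ~ f ∈ B.
Proof.
  intros tree.
  set (W := sep (pow omega) (fun y => perfect_set (body d0 d1 y))).
  assert (Db : definable_term (fun r => body d0 d1 (r 0)))
    by (unfold body; def).
  assert (HW : forall y, y ∈ W <-> sub y omega /\ perfect_set (body d0 d1 y)).
  { intros y. unfold W. rewrite sep_spec by def. now rewrite pow_spec. }
  assert (Hsub : forall y, sub (body d0 d1 y) (branches d0 d1)).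
  { intros y f Hf. now apply body_spec in Hf. }
  destruct (disjoint_refinement W (branches d0 d1) (body d0 d1) Db)
    as [q [q_dom [q_val q_inj]]].
  - intros y _. apply Hsub.
  - intros y Hy. apply HW in Hy. apply (surj_sub _ (pow omega)).
    + apply (perfect_surj d0 d1 tree); [apply Hsub|apply Hy].
    + intros z Hz. apply HW in Hz. now apply pow_spec.
  - set (B := sep (branches d0 d1)
      (fun f => exists y, opair y f ∈ q /\ ~ empty_set ∈ y)).
    assert (HB : forall f, f ∈ B <-> f ∈ branches d0 d1 /\
      exists y, opair y f ∈ q /\ ~ empty_set ∈ y).
    { intros f. unfold B. rewrite sep_spec by def. reflexivity. }
    exists B. split; [intros f Hf; now apply HB in Hf|].
    intros Q HQ HQb.
    (* The root is a node of every branch, so [y1] contains 0, and its removal gives the second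
       code. *)
    set (y1 := nodes Q). set (y0 := diff y1 (upair empty_set empty_set)).
    assert (E1 : body d0 d1 y1 = Q)
      by (apply (body_nodes d0 d1 tree); auto; reflexivity).
    assert (E0 : body d0 d1 y0 = Q).
    { apply (body_nodes d0 d1 tree); auto. intros u Hu. unfold y0.
      rewrite diff_spec, upair_spec. tauto. }
    assert (S1 : sub y1 omega) by (intros u Hu; now apply nodes_spec in Hu).
    assert (W1 : y1 ∈ W) by (apply HW; rewrite E1; auto).
    assert (W0 : y0 ∈ W).
    { apply HW. rewrite E0. split; [|exact HQ]. intros u Hu.
      apply diff_spec in Hu. apply S1, Hu. }
    destruct (q_dom y0 W0) as [f [Hf K]], (q_dom y1 W1) as [g [Hg L]].
    rewrite E0 in Hf. rewrite E1 in Hg. split.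
    + exists f. split; [exact Hf|]. apply HB. split; [auto|]. exists y0.
      split; [exact K|]. unfold y0. rewrite diff_spec, upair_spec. tauto.
    + exists g. split; [exact Hg|]. intros H. apply HB in H.
      (* Points chosen for different codes differ, so a code that puts [g] into [B] could only be
         [y1], which contains 0. *)
      destruct H as [_ [y [Hy N]]]. apply N.
      rewrite (q_inj _ _ _ Hy L). apply nodes_spec.
      split; [apply omega_zero|]. destruct HQ as [[h Hh] _].
      exists h, empty_set. split; [exact Hh|]. split; [apply omega_zero|].
      symmetry. apply (branch_zero d0 d1); auto.
Qed.

Lemma shifted_branch d0 d1 f : f ∈ branches d0 d1 ->
  exists g, g ∈ baire /\ ap g empty_set = suc empty_set /\
    forall n : M, n ∈ omega -> ap g (suc n) = ap f (suc n).
Proof.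
  intros Hf.
  destruct (isfun_graph omega omega (fun n y =>
    n = empty_set /\ y = suc empty_set \/ n <> empty_set /\ y = ap f n))
    as [g [Hg K]]; [def| |].
  - intros n Hn. destruct (classic (n = empty_set)) as [E|E].
    + exists (suc empty_set). split; [apply omega_suc, omega_zero|].
      split; [tauto|]. intros z _. tauto.
    + exists (ap f n). split; [now apply (branch_cod d0 d1)|].
      split; [tauto|]. intros z _. tauto.
  - exists g. split; [now apply baire_spec|]. split.
    + destruct (K _ omega_zero) as [[_ E]|[E _]]; tauto.
    + intros n Hn. destruct (K _ (omega_suc n Hn)) as [[E _]|[_ E]];
        [destruct (suc_nonzero _ E)|exact E].
Qed.

(** The disjunction has the form that [interp] gives to [Or], so that the theorem matches the
    formula by conversion. *)
Definition s_measurable_set (A : M) : Prop :=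
  forall P, perfect_set P -> exists Q, perfect_set Q /\ sub Q P /\
    (~ sub Q A -> forall x, x ∈ Q -> ~ x ∈ A).

Theorem mad_not_s_measurable_exists :
  exists A : M, mad_family A /\ ~ s_measurable_set A.
Proof.
  destruct binary_tree_exists as [d0 [d1 tree]].
  destruct (bernstein_set d0 d1 tree) as [B [HBP HB]].
  set (P := branches d0 d1) in *.
  set (shifted f g := ap g empty_set = suc empty_set /\
    forall n : M, n ∈ omega -> ap g (suc n) = ap f (suc n)).
  set (A0 := sep baire (fun g => g ∈ B \/
    exists f, f ∈ P /\ ~ f ∈ B /\ shifted f g)).
  assert (HA0 : forall g, g ∈ A0 <-> g ∈ baire /\ (g ∈ B \/
    exists f, f ∈ P /\ ~ f ∈ B /\ shifted f g)).
  { intros g. unfold A0. rewrite sep_spec by (unfold shifted; def).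
    reflexivity. }
  (* Each member of [A0] stems from a branch [f] with the same values at successors. *)
  assert (base : forall g, g ∈ A0 -> exists f, f ∈ P /\
    (forall n, n ∈ omega -> ap g (suc n) = ap f (suc n)) /\
    (f ∈ B /\ g = f \/ ~ f ∈ B /\ shifted f g)).
  { intros g Hg. apply HA0 in Hg. destruct Hg as [_ [Hg|[f [Hf [N K]]]]].
    - exists g. auto.
    - exists f. split; [exact Hf|]. split; [apply K|auto]. }
  assert (ad0 : ad A0).
  { split; [intros g Hg; now apply HA0 in Hg|]. intros g h [Hg [Hh N]].
    assert (Hgb : g ∈ baire) by now apply HA0 in Hg.
    assert (Hhb : h ∈ baire) by now apply HA0 in Hh.
    destruct (base g Hg) as [f [Hf [Eg Cg]]], (base h Hh) as [f' [Hf' [Eh Ch]]].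
    (* A branch contributes one function only: itself if it lies in [B], its modification
       otherwise. *)
    assert (D : f <> f').
    { intros <-. apply N. destruct Cg as [[Fg ->]|[Fg [Zg _]]],
        Ch as [[Fh ->]|[Fh [Zh _]]]; try tauto.
      apply baire_ext; [assumption..|]. intros n Hn.
      destruct (omega_cases n Hn) as [-> | [m [Hm ->]]]; [congruence|].
      now rewrite Eg, Eh. }
    destruct (branch_split d0 d1 f f' Hf Hf' D) as [n [Hn [_ S]]].
    apply (evdiff_intro g h (suc n)); auto using omega_suc.
    (* Two modified functions do meet at 0; the bound [suc n] is positive and covers this
       coincidence. *)
    intros k Hk E. destruct (omega_cases k Hk) as [-> | [m [Hm ->]]].
    - destruct (zero_or_mem (suc n) (omega_suc n Hn)) as [K|K]; [|exact K].
      symmetry in K. destruct (suc_nonzero _ K).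
    - rewrite Eg, Eh in E by exact Hm.
      apply (branch_differ d0 d1 tree f f'); auto using omega_suc. }
  destruct (mad_extension A0 ad0) as [A [[[HAb HA] HAm] HAA]].
  exists A. split; [split; [split|]; assumption|]. intros SM.
  destruct (SM P (branches_perfect d0 d1 tree)) as [Q [HQ [HQP K]]].
  destruct (HB Q HQ HQP) as [[f [Hf HfB]] [g [Hg HgB]]].
  (* A point of [Q] in [B] lies in [A], which excludes the disjoint case. So [g], outside [B], lies
     in [A] together with its modification [h], against almost disjointness. *)
  assert (S : sub Q A).
  { apply NNPP. intros N. apply (K N f Hf), HAA, HA0.
    split; [|auto]. apply (branch_baire d0 d1). now apply HQP. }
  assert (HgP : g ∈ P) by auto.
  destruct (shifted_branch d0 d1 g HgP) as [h [Hh Kh]].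
  assert (HhA : h ∈ A) by (apply HAA, HA0; split; [exact Hh|eauto]).
  destruct (evdiff_differ g h) as [n [Hn D]].
  - auto.
  - auto.
  - apply HA. split; [auto|]. split; [exact HhA|]. intros <-.
    destruct Kh as [Kh _]. rewrite (branch_zero d0 d1 g HgP) in Kh.
    symmetry in Kh. destruct (suc_nonzero _ Kh).
  - apply D. symmetry. now apply Kh.
Qed.

End Main.

Lemma zfc_closed p : ZFC p -> fbound p = 0.
Proof. intros H. destruct H; try reflexivity; apply fbound_closure. Qed.

(** * The sentence read in a model *)

Section Final.

Context {M : Type} {Z : zfc_model M}.

Lemma suc_shape (s n : M) :
  (forall x, (x ∈ s -> ~ x ∈ n -> x = n) /\ ((~ x ∈ n -> x = n) -> x ∈ s)) <->
  s = suc n.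
Proof.
  split.
  - intros H. apply set_ext. intros x. rewrite suc_spec.
    destruct (H x) as [K L]. destruct (classic (x ∈ n)); tauto.
  - intros -> x. rewrite suc_spec. tauto.
Qed.

Definition inductive_shape (i : M) : Prop :=
  (exists e, (forall x, ~ x ∈ e) /\ e ∈ i) /\
  forall n, n ∈ i -> exists s,
    (forall x, (x ∈ s -> ~ x ∈ n -> x = n) /\ ((~ x ∈ n -> x = n) -> x ∈ s)) /\
    s ∈ i.

Lemma inductive_shape_iff i : inductive_shape i <-> ind_set i.
Proof.
  unfold inductive_shape, ind_set. setoid_rewrite suc_shape.
  assert (E : forall e : M, (forall x, ~ x ∈ e) -> e = empty_set).
  { intros e He. apply set_ext. intros x. split; intros Hx.
    - destruct (He x Hx).
    - destruct (empty_spec _ Hx). }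
  split; intros [H K]; split.
  - destruct H as [e [He H]]. now rewrite <- (E e).
  - intros n Hn. destruct (K n Hn) as [s [-> L]]. exact L.
  - exists empty_set. split; [exact empty_spec|exact H].
  - eauto.
Qed.

Lemma interp_mad_not_s_measurable (e : nat -> M) :
  interp mem e (mad_not_s_measurable 0).
Proof.
  (* Conversion checks that the de Bruijn formula really has this meaning in [M]. Pairs, functions
     and successors keep their raw shapes until they are rewritten. *)
  change (exists w N : M,
    (inductive_shape w /\ forall i, inductive_shape i -> sub w i) /\
    (forall f, f ∈ N <-> isfun_shape f w w) /\
    exists A,
    let evdiff f g := exists c, (forall x, x ∈ c <-> x ∈ f /\ x ∈ g) /\
      exists n h, n ∈ w /\ isfun_shape h n c /\ forall y, y ∈ c ->
        exists x, maps_shape h x y /\ forall z, maps_shape h z y -> z = x in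
    let ad B := sub B N /\
      forall f g, f ∈ B /\ g ∈ B /\ ~ f = g -> evdiff f g in
    let is_open U := sub U N /\ forall f, f ∈ U -> exists n, n ∈ w /\
      forall g, g ∈ N /\ (forall k, k ∈ n ->
        exists y, maps_shape f k y /\ maps_shape g k y) -> g ∈ U in
    let is_closed C := sub C N /\
      exists U, is_open U /\ forall f, f ∈ N -> (f ∈ C <-> ~ f ∈ U) in
    let is_perfect P := (exists f, f ∈ P) /\ is_closed P /\
      forall f, f ∈ P ->
        ~ exists U, is_open U /\ forall g, (g ∈ U /\ g ∈ P) <-> g = f in
    (ad A /\ forall B, ad B /\ sub A B -> B = A) /\
    ~ forall P, is_perfect P -> exists Q, is_perfect Q /\ sub Q P /\
        (~ sub Q A -> forall x, x ∈ Q -> ~ x ∈ A)).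
  rewrite maps_shape_eq, isfun_shape_eq. exists omega, baire.
  split; [|split; [exact baire_spec|exact mad_not_s_measurable_exists]].
  split.
  - apply inductive_shape_iff. split; [apply omega_zero|apply omega_suc].
  - intros i Hi x Hx. apply (proj1 (omega_spec x) Hx).
    now apply inductive_shape_iff.
Qed.

End Final.

Theorem theorem4p1 :
  consistent ZFC -> consistent (extend ZFC (mad_not_s_measurable 0)).
Proof.
  intros H. destruct (model_existence ZFC zfc_closed H) as [D [E [e HE]]].
  pose (Z := {| mem := E; point := e 0; zfc_sat := fun p e' => HE p e' |}).
  apply (consistent_of_sat E e). intros p [Hp|Hp].
  - now apply HE.
  - rewrite Hp. apply interp_sat. exact (@interp_mad_not_s_measurable D Z e).
Qed.
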